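(* Let $k\geq 1$ and let $\Theta\leq \mathrm{Sym}(\{0,\dots,k-1\})$ be a subgroup. Then there exists a sharply $\Theta$-transitive action of a group on an infinite set if and only if $\Theta$ is robust. Moreover, if such an action exists, then there exists such an action for which the acting group is a finitely generated non-abelian virtually free group.
   Context: All actions are right actions. Write $\mathbf{k}=\{0,\dots,k-1\}$ and let $\pi:\mathbf{k}\curvearrowleft\Theta$ be the natural permutation action of $\Theta\leq\mathrm{Sym}(\mathbf{k})$. An isomorphism between actions $X\curvearrowleft G$ and $X'\curvearrowleft G'$ is a bijection $\alpha:X\to X'$ together with a group isomorphism $f:G\to G'$ such that $\alpha(x\cdot g)=\alpha(x)\cdot f(g)$ for all $x\in X$, $g\in G$. An action of a group $G$ on a set $U$ with $|U|\geq k$ is sharply $\Theta$-transitive if it is transitive on the set of $k$-element subsets of $U$ and, for each $k$-element subset $A\subseteq U$, the action $A\curvearrowleft G_{\{A\}}$ of the setwise stabiliser $G_{\{A\}}$ of $A$ is isomorphic to $\pi:\mathbf{k}\curvearrowleft\Theta$. An orbit of an action is free if the stabiliser of each of its points is trivial. For $\Omega\leq\Theta$, let $\mathrm{NFr}_\pi(\Omega)\subseteq\mathbf{k}$ denote the union of the non-free orbits of the restricted action $\pi|_\Omega:\mathbf{k}\curvearrowleft\Omega$. The permutation group $\Theta$ is robust if for each subgroup $\Omega\leq\Theta$ and each non-empty $\Omega$-invariant subset $X\subseteq\mathrm{NFr}_\pi(\Omega)$, the integer $|\Omega|$ does not divide $|X|$. A group is virtually free if it has a free subgroup of finite index. *)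

(* Defs.v *)
From HB Require Import structures.
From mathcomp Require Import all_boot all_fingroup.

Set Implicit Arguments.
Unset Strict Implicit.
Unset Printing Implicit Defensive.

Import GroupScope.

Section Robust.
Variable k : nat.

(* 'P is a right action: (s * t) x = t (s x) in {perm 'I_k}. *)
Definition free_orbit (Omega : {group 'S_k}) (O : {set 'I_k}) : bool :=
  [forall x in O, 'C_Omega[x | 'P] == 1].

Definition NFr (Omega : {group 'S_k}) : {set 'I_k} :=
  \bigcup_(O in [set orbit 'P Omega x | x : 'I_k] | ~~ free_orbit Omega O) O.

Definition robust (Theta : {group 'S_k}) : Prop :=
  forall (Omega : {group 'S_k}) (X : {set 'I_k}),
    Omega \subset Theta -> X != set0 -> [acts Omega, on X | 'P] ->
    X \subset NFr Omega -> ~~ (#|Omega| %| #|X|)%N.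

End Robust.

From mathcomp Require Import boolp classical_sets functions cardinality.

Local Open Scope classical_set_scope.
Local Open Scope card_scope.

Record right_action (G : groupType) (U : Type) := RAction {
  ract :> U -> G -> U;
  ract1 : forall x, ract x 1 = x;
  ractM : forall x g h, ract x (g * h) = ract (ract x g) h
}.

(* The action X <- H obtained by restricting "to" to the invariant set X and the
   subgroup H is isomorphic to X' <- H'. As is usual for set_bij, alpha and f
   are total functions whose values outside X and H are irrelevant. *)
Definition action_iso (U U' : Type) (G G' : groupType)
    (X : set U) (H : set G) (to : U -> G -> U)
    (X' : set U') (H' : set G') (to' : U' -> G' -> U') : Prop :=
  exists (alpha : U -> U') (f : G -> G'),
    [/\ set_bij X X' alpha,
        set_bij H H' f,
        (forall g h, H g -> H h -> f (g * h) = f g * f h)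
      & (forall x g, X x -> H g -> alpha (to x g) = to' (alpha x) (f g))].

Section SharplyTransitive.
Variables (G : groupType) (U : Type) (to : right_action G U).

Definition set_stab (A : set U) : set G := [set g | to^~ g @` A = A].

Definition sharply_transitive (k : nat) (Theta : {group 'S_k}) : Prop :=
  [/\ `I_k #<= [set: U],
      (forall A B : set U, A #= `I_k -> B #= `I_k ->
         exists g : G, to^~ g @` A = B)
    & (forall A : set U, A #= `I_k ->
         action_iso A (set_stab A) to
           [set: 'I_k] [set s : 'S_k | s \in Theta] (@aperm 'I_k))].

End SharplyTransitive.

Section GroupProperties.
Variable G : groupType.

Definition subgroup (H : set G) : Prop := group_closed (mem H).

Definition finitely_generated : Prop :=
  exists2 S : set G, finite_set S & smallest subgroup S = [set: G].

(* The letter (s, b) stands for s^-1 if b and for s otherwise. *)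
Definition word_val (w : seq (G * bool)) : G :=
  \prod_(l <- w) (if l.2 then l.1^-1 else l.1).

Definition reduced (w : seq (G * bool)) : bool :=
  sorted (fun l m => ~~ ((l.1 == m.1) && (l.2 != m.2))) w.

Definition reduced_words (S : set G) : set (seq (G * bool)) :=
  [set w | reduced w /\ forall l, l \in w -> S l.1].

(* H is free on S: evaluation of reduced words is a bijection F(S) -> H. *)
Definition free_on (H S : set G) : Prop :=
  set_bij (reduced_words S) H word_val.

Definition free_subgroup (H : set G) : Prop :=
  subgroup H /\ exists S : set G, free_on H S.

Definition finite_index (H : set G) : Prop :=
  finite_set (range (fun g : G => [set h * g | h in H])).

Definition virtually_free : Prop :=
  exists2 H : set G, free_subgroup H & finite_index H.

Definition abelian_group : Prop := forall g h : G, commute g h.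

End GroupProperties.

Arguments finitely_generated : clear implicits.
Arguments virtually_free : clear implicits.
Arguments abelian_group : clear implicits.

(* Main.v *)
(** Necessity: let Omega <= Theta act on a k-set A as on k, and let X in NFr(Omega)
    be invariant with |Omega| dividing |X|. Replacing X by free Omega-orbits of U
    gives infinitely many Omega-invariant k-sets B = A g containing A \ X. The
    points x g^-1 (x in A) lie in the finite set made of A and of the fixed points
    of the nontrivial elements of Theta (nontrivial elements fix fewer than k
    points), so g, hence B, takes only finitely many values.

    Sufficiency: the acting group is F(S) x| Theta, where F(S) is the free group on
    a finite Theta-set S in which the subgroups of Theta with a free point in k
    occur as stabilisers. It acts on U = k + (infinitely many regular
    Theta-orbits); F(S) must act regularly on k-sets, that is, the S-labelled graph
    on the k-subsets of U must be a tree. This action is the union of finite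
    Theta-equivariant partial actions whose graphs on k-sets are forests. At each
    step either a leaf is added, or the component of a k-set B is joined to that
    of k. In the second case the stabiliser Omega of the component fixes one of its
    vertices, which we take as B; counting points modulo |Omega|, robustness gives
    NFr(Omega) in B, so that B and k are isomorphic Omega-sets. Letters with
    stabiliser Omega fix NFr(Omega) pointwise and move the other points of B and k
    to fresh points, where the two sets are connected by long equivariant paths.
    No k-set other than the translates of B can follow such a path from end to end,
    and as distinct translates lie in distinct components no cycle arises. *)

From HB Require Import structures.
Require Import Defs.
From mathcomp Require Import all_boot all_fingroup.
From mathcomp Require Import finmap.
From mathcomp Require Import boolp classical_sets functions cardinality.
From mathcomp Require Import zify.

Set Implicit Arguments.
Unset Strict Implicit.
Unset Printing Implicit Defensive.

(** * Subgroups, and groups of bijections as group types *)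

Lemma subgroupP (G : groupType) (H : set G) : subgroup H <->
  H 1%g /\ forall g h, H g -> H h -> H (g * h^-1)%g.
Proof.
split=> [[h1 hd]|[h1 hd]].
  split; first exact: set_mem h1.
  by move=> g h hg hh; apply: set_mem; apply: hd; apply: mem_set.
split; first exact: mem_set.
by move=> g h /set_mem hg /set_mem hh; apply: mem_set; exact: hd.
Qed.

(* A group of bijections of U, acting on the right: f * g is g \o f. *)
Section FunctionGroup.
Variables (U : Type) (P : (U -> U) -> Prop).
Hypotheses (P1 : P id) (PM : forall f g, P f -> P g -> P (g \o f))
  (PV : forall f, P f -> exists g, [/\ P g, cancel f g & cancel g f]).

(** The closure proofs are arguments of the type, so that the group structure can be inferred from
    the type alone. *)
Definition fgroup of P id & (forall f g, P f -> P g -> P (g \o f)) &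
  (forall f, P f -> exists g, [/\ P g, cancel f g & cancel g f]) : Type :=
  {f : U -> U | P f}.
Local Notation G := (fgroup P1 PM PV).
HB.instance Definition _ := gen_eqMixin G.
HB.instance Definition _ := gen_choiceMixin G.

Lemma fgroup_ext (f g : G) : sval f =1 sval g -> f = g.
Proof. by case: f g => [f pf] [g pg] /= fg; apply: eq_exist; apply/funext. Qed.

Definition fgroup_one : G := exist _ id P1.
Definition fgroup_mul (f g : G) : G :=
  exist _ (sval g \o sval f) (PM (svalP f) (svalP g)).
Definition fgroup_inv (f : G) : G :=
  let g := cid (PV (svalP f)) in exist _ (sval g) (let: And3 p _ _ := svalP g in p).

Lemma fgroup_invK (f : G) :
  cancel (sval f) (sval (fgroup_inv f)) /\ cancel (sval (fgroup_inv f)) (sval f).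
Proof. by rewrite /fgroup_inv; case: cid => g []. Qed.

Lemma fgroup_mulA : associative fgroup_mul.
Proof. by move=> f g h; exact: fgroup_ext. Qed.
Lemma fgroup_mul1 : left_id fgroup_one fgroup_mul.
Proof. by move=> f; exact: fgroup_ext. Qed.
Lemma fgroup_mulr1 : right_id fgroup_one fgroup_mul.
Proof. by move=> f; exact: fgroup_ext. Qed.
Lemma fgroup_mulV : left_inverse fgroup_one fgroup_inv fgroup_mul.
Proof. by move=> f; apply: fgroup_ext => x; exact: (fgroup_invK f).2. Qed.
Lemma fgroup_mulrV : right_inverse fgroup_one fgroup_inv fgroup_mul.
Proof. by move=> f; apply: fgroup_ext => x; exact: (fgroup_invK f).1. Qed.

HB.instance Definition _ := isGroup.Build G fgroup_mulA fgroup_mul1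
  fgroup_mulr1 fgroup_mulV fgroup_mulrV.

Definition fgroup_action : right_action G U := @RAction G U (fun x f => sval f x)
  (fun=> erefl) (fun _ _ _ => erefl).

End FunctionGroup.

(** * Equivariant labelled graphs on points, and the walks they induce on k-sets *)

Section Graph.
Local Open Scope fset_scope.
Variables (T : finGroupType) (I S : finType).
Variables (ia : I -> T -> I) (sa : S -> T -> S).
Hypotheses (ia1 : forall i, ia i 1%g = i)
  (iaM : forall i t u, ia i (t * u)%g = ia (ia i t) u)
  (sa1 : forall s, sa s 1%g = s)
  (saM : forall s t u, sa s (t * u)%g = sa (sa s t) u).

(* I is the distinguished k-set; (n, t) runs over regular T-orbits indexed by n. *)
Definition pt : Type := (I + nat * T)%type.
HB.instance Definition _ := Countable.on pt.

Definition pa (x : pt) (t : T) : pt :=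
  match x with inl i => inl (ia i t) | inr u => inr (u.1, (u.2 * t)%g) end.

Definition letter : Type := (S * bool)%type.
HB.instance Definition _ := Finite.on letter.

(* The letter (s, b) stands for s^-1 if b and for s otherwise. *)
Definition linv (l : letter) : letter := (l.1, ~~ l.2).
Definition la (l : letter) (t : T) : letter := (sa l.1 t, l.2).
(* By equivariance s maps x to a point fixed by t, and t may only fix points of
   the distinguished k-set; such an s is made to fix x. *)
Definition fixl (x : pt) (s : S) : Prop :=
  exists t : T, [/\ t != 1%g, pa x t = x & sa s t = s].

Lemma pa1 x : pa x 1%g = x.
Proof. by case: x => [i|[n u]] /=; rewrite ?ia1 ?mulg1. Qed.

Lemma paM x t u : pa x (t * u)%g = pa (pa x t) u.
Proof. by case: x => [i|[n v]] /=; rewrite ?iaM ?mulgA. Qed.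

Lemma paK t : cancel (pa^~ t) (pa^~ t^-1%g).
Proof. by move=> x; rewrite -paM mulgV pa1. Qed.

Lemma paKV t : cancel (pa^~ t^-1%g) (pa^~ t).
Proof. by move=> x; rewrite -paM mulVg pa1. Qed.

Lemma la1 l : la l 1%g = l.
Proof. by case: l => s b; rewrite /la sa1. Qed.

Lemma laM l t u : la l (t * u)%g = la (la l t) u.
Proof. by rewrite /la saM. Qed.

Lemma laK t : cancel (la^~ t) (la^~ t^-1%g).
Proof. by move=> l; rewrite -laM mulgV la1. Qed.

Lemma linvK : involutive linv.
Proof. by case=> s b; rewrite /linv negbK. Qed.

Lemma linv_neq l : linv l != l.
Proof. by apply/eqP => /(congr1 snd) /=; case: l.2. Qed.

Lemma la_linv l t : la (linv l) t = linv (la l t).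
Proof. by []. Qed.

Definition fa (A : {fset pt}) (t : T) : {fset pt} := [fset pa x t | x in A].

Lemma faP A t y : reflect (exists2 x, x \in A & y = pa x t) (y \in fa A t).
Proof. exact: imfsetP. Qed.

Lemma mem_fa A t x : (pa x t \in fa A t) = (x \in A).
Proof.
apply/faP/idP => [[y yA /(can_inj (paK t)) ->] //|xA]; by exists x.
Qed.

Lemma in_fa A t x : (x \in fa A t) = (pa x t^-1%g \in A).
Proof. by rewrite -{1}(paKV t x) mem_fa. Qed.

Lemma fa1 A : fa A 1%g = A.
Proof. by apply/fsetP => x; rewrite in_fa invg1 pa1. Qed.

Lemma faM A t u : fa A (t * u)%g = fa (fa A t) u.
Proof. by apply/fsetP => x; rewrite !in_fa invMg paM. Qed.

Lemma faK t : cancel (fa^~ t) (fa^~ t^-1%g).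
Proof. by move=> x; rewrite -faM mulgV fa1. Qed.

Lemma card_fa A t : #|` fa A t| = #|` A|.
Proof. by rewrite card_imfset //; exact: can_inj (paK t). Qed.

Definition graph := pt -> letter -> pt -> Prop.

(** In a pregraph each letter is a partial injection; a step requires it to be defined on all of
    [A], with image exactly [B]. *)
Definition sstep (E : graph) (A : {fset pt}) (l : letter) (B : {fset pt}) :=
  (forall x, x \in A -> exists2 y, y \in B & E x l y) /\
  (forall y, y \in B -> exists2 x, x \in A & E x l y).

Fixpoint walk (E : graph) A (w : seq letter) B : Prop :=
  if w is l :: w' then exists2 C, sstep E A l C & walk E C w' B else A = B.

Fixpoint chain (E : graph) (l : letter) n x y : Prop :=
  if n is n'.+1 then exists2 z, E x l z & chain E l n' z y else x = y.

Definition nonback (l m : letter) := m != linv l.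
Definition reducedw := sorted nonback.
Definition winv (w : seq letter) := rev (map linv w).
Definition kset (A : {fset pt}) := #|` A| = #|I|.

(* The graph on k-sets has no cycle: no nontrivial element of the free group
   stabilises a k-set. *)
Definition forest (E : graph) :=
  forall A w, kset A -> reducedw w -> walk E A w A -> w = [::].

Definition conn E A B := exists w, walk E A w B.

Record pregraph (E : graph) : Prop := Pregraph {
  g_eq : forall x l y t, E x l y -> E (pa x t) (la l t) (pa y t);
  g_sym : forall x l y, E x l y -> E y (linv l) x;
  g_fun : forall x l y y', E x l y -> E x l y' -> y = y' }.

Record nice (E : graph) : Prop := Nice {
  g_pre :> pregraph E;
  g_loop : forall x l, fixl x l.1 -> E x l x;
  g_for : forest E }.

Definition below M (x : pt) := if x is inr u then u.1 < M else true.

Definition bounded (E : graph) M := forall x l y, E x l y -> below M x.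

(* Orbits of a single letter are bounded, apart from the forced fixed points. *)
Definition short (E : graph) K :=
  forall x l y, chain E l K x y -> fixl x l.1.

Record good (E : graph) : Prop := Good {
  g_nice :> nice E;
  g_bd : exists M, bounded E M;
  g_short : exists K, short E K }.

Lemma nonback_la t l m : nonback (la l t) (la m t) = nonback l m.
Proof. by rewrite /nonback -la_linv (can_eq (laK t)). Qed.

Lemma reducedw_la t w : reducedw (map (la^~ t) w) = reducedw w.
Proof. by rewrite /reducedw sorted_map; apply: eq_sorted => l m; exact: nonback_la. Qed.

Lemma reducedw_winv w : reducedw (winv w) = reducedw w.
Proof.
rewrite /reducedw /winv rev_sorted sorted_map; apply: eq_sorted => l m /=.
by rewrite /nonback linvK eq_sym.
Qed.

Lemma winvK : involutive winv.
Proof. by move=> w; rewrite /winv map_rev revK mapK //; exact: linvK. Qed.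

Lemma winv_cons l w : winv (l :: w) = rcons (winv w) (linv l).
Proof. by rewrite /winv /= rev_cons. Qed.

Lemma winv_rcons l w : winv (rcons w l) = linv l :: winv w.
Proof. by rewrite /winv map_rcons rev_rcons. Qed.

Lemma size_winv w : size (winv w) = size w.
Proof. by rewrite size_rev size_map. Qed.

Lemma reducedw_join p x y q : reducedw (rcons p x) -> reducedw (y :: q) ->
  nonback x y -> reducedw (rcons p x ++ y :: q).
Proof.
rewrite /reducedw cat_rcons; case: p => [|a p] /=; first by move=> _ -> ->.
by rewrite rcons_path cat_path /= => /andP[-> ->] -> ->.
Qed.

Lemma reducedw_cat p q : reducedw (p ++ q) -> reducedw p /\ reducedw q.
Proof. by rewrite /reducedw => /cat_sorted2[-> ->]. Qed.

Lemma walk_cat E A w1 w2 B :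
  walk E A (w1 ++ w2) B <-> exists2 C, walk E A w1 C & walk E C w2 B.
Proof.
elim: w1 A => [|l w IH] A /=.
  by split=> [h|[C ->] //]; exists A.
split=> [[C s /IH[D h1 h2]]|[D [C s h1] h2]].
  by exists D => //; exists C.
by exists C => //; apply/IH; exists D.
Qed.

Lemma walk_rcons E A w l B :
  walk E A (rcons w l) B <-> exists2 C, walk E A w C & sstep E C l B.
Proof.
rewrite -cats1 walk_cat /=; split=> [[C h [D s <-]]|[C h s]]; exists C => //.
by exists B.
Qed.

Lemma walk_mono (E E' : graph) A w B : (forall x l y, E x l y -> E' x l y) ->
  walk E A w B -> walk E' A w B.
Proof.
move=> sub; elim: w A => //= l w IH A [C [s1 s2] /IH h]; exists C => //.
by split=> x => [/s1|/s2] [y yC /sub e]; exists y.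
Qed.

Lemma chain_sstep E A l n B : walk E A (nseq n l) B ->
  forall x, x \in A -> exists2 y, y \in B & chain E l n x y.
Proof.
elim: n A => [|n IH] A /=; first by move=> -> x xB; exists x.
case=> C [s1 _] /IH h x /s1[y /h[z zB yz] xy]; exists z => //.
by exists y.
Qed.

Lemma chain_cat E l m n x y z :
  chain E l m x y -> chain E l n y z -> chain E l (m + n) x z.
Proof. by elim: m x => [|m IH] x /= => [->//|[u xu /IH h /h]]; exists u. Qed.

Lemma chain_split E l m n x z : chain E l (m + n) x z ->
  exists2 y, chain E l m x y & chain E l n y z.
Proof.
elim: m x => [|m IH] x /=; first by exists x.
by case=> y xy /IH[u h1 h2]; exists u => //; exists y.
Qed.

(** * Reduced walks in a forest, and fixed vertices of subgroups of [T] *)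

Section Pregraph.
Variables (E : graph) (nE : pregraph E).

Lemma sstep_act A l B t : sstep E A l B -> sstep E (fa A t) (la l t) (fa B t).
Proof.
case=> s1 s2; split=> _ /faP[x /[dup] xA + ->].
  by move=> /s1[y yB xy]; exists (pa y t); rewrite ?mem_fa //; apply: g_eq.
by move=> /s2[y yB xy]; exists (pa y t); rewrite ?mem_fa //; apply: g_eq.
Qed.

Lemma sstep_sym A l B : sstep E A l B -> sstep E B (linv l) A.
Proof.
by case=> s1 s2; split=> x => [/s2|/s1][y yA xy]; exists y => //; exact: g_sym.
Qed.

Lemma sstep_fun A l B C : sstep E A l B -> sstep E A l C -> B = C.
Proof.
move=> [s1 s2] [t1 t2]; apply/fsetP => x; apply/idP/idP.
  move=> /s2[y /t1[z zC yz] yx]; by rewrite (g_fun nE yx yz).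
move=> /t2[y /s1[z zC yz] yx]; by rewrite (g_fun nE yx yz).
Qed.

Lemma sstep_card_le A l B : sstep E A l B -> #|` A| <= #|` B|.
Proof.
move=> sAB; have [s1 _] := sAB.
have /choice[f fP] : forall x : pt, exists y, x \in A -> y \in B /\ E x l y.
  move=> x; have [xA|] := boolP (x \in A); last by exists x.
  by have [y] := s1 _ xA; exists y.
have <- : #|` [fset f x | x in A]| = #|` A|.
  rewrite card_in_imfset // => x y xA yA e.
  have [_ /(g_sym nE) h1] := fP _ xA.
  by have [_ /(g_sym nE)] := fP _ yA; rewrite -e; apply: g_fun h1.
by apply: fsubset_leq_card; apply/fsubsetP => _ /imfsetP[x /= /fP[+ _] ->].
Qed.

Lemma sstep_card A l B : sstep E A l B -> #|` A| = #|` B|.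
Proof.
move=> s; apply/eqP; rewrite eqn_leq (sstep_card_le s) /=.
exact: sstep_card_le (sstep_sym s).
Qed.

Lemma walk_act A w B t :
  walk E A w B -> walk E (fa A t) (map (la^~ t) w) (fa B t).
Proof.
elim: w A => [|l w IH] A /=; first by move=> ->.
by move=> [C s /IH h]; exists (fa C t) => //; exact: sstep_act.
Qed.

Lemma walk_inv A w B : walk E A w B -> walk E B (winv w) A.
Proof.
elim: w A => [|l w IH] A /=; first by move=> ->.
move=> [C s /IH h]; rewrite winv_cons; apply/walk_rcons; exists C => //.
exact: sstep_sym.
Qed.

Lemma walk_fun A w B C : walk E A w B -> walk E A w C -> B = C.
Proof.
elim: w A => [|l w IH] A /=; first by move=> -> ->.
by move=> [D s h] [D' s' h']; move: h'; rewrite -(sstep_fun s s'); exact: IH.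
Qed.

Lemma walk_card A w B : walk E A w B -> #|` A| = #|` B|.
Proof.
elim: w A => [|l w IH] A /=; first by move=> ->.
by move=> [D /sstep_card-> /IH].
Qed.

Lemma walk_reduce A w B : walk E A w B ->
  exists w', reducedw w' /\ walk E A w' B.
Proof.
elim: w A => [|l w IH] A /=; first by move=> ->; exists [::].
move=> [C s /IH[[|m u] [ru h]]].
  by exists [:: l]; split=> //; exists C.
have [e|ne] := boolP (nonback l m).
  by exists [:: l, m & u]; split; [rewrite /reducedw /= e | exists C].
move: ne h ru; rewrite negbK => /eqP-> [D /= s' h] /path_sorted ru.
by exists u; split=> //; rewrite (sstep_fun (sstep_sym s) s').
Qed.

Lemma conn_refl A : conn E A A.
Proof. by exists [::]. Qed.

Lemma conn_sym A B : conn E A B -> conn E B A.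
Proof. by case=> w /walk_inv; exists (winv w). Qed.

Lemma conn_trans A B C : conn E A B -> conn E B C -> conn E A C.
Proof. by case=> v h [w h']; exists (v ++ w); apply/walk_cat; exists B. Qed.

Lemma conn_act A B t : conn E A B -> conn E (fa A t) (fa B t).
Proof. by case=> v /(walk_act t) h; eexists; exact: h. Qed.

Lemma conn_card A B : conn E A B -> #|` A| = #|` B|.
Proof. by case=> w /walk_card. Qed.

Hypothesis fE : forest E.

(** Once the common prefix is cancelled, one walk reversed and followed by the other is a reduced
    closed walk, which a forest forbids unless it is empty. *)
Lemma walk_unique A w w' B : kset A -> reducedw w -> reducedw w' ->
  walk E A w B -> walk E A w' B -> w = w'.
Proof.
elim: w A w' => [|l w IH] A [|l' w'] kA rw rw' h h'.
- by [].
- move: h h' => /= <- h'; exact/esym/(fE kA rw').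
- move: h' h => /= <- h; exact/(fE kA rw).
have [e|ne] := eqVneq l l'.
  move: h h'; rewrite -e => -[C s h] [D s' h'].
  congr cons; apply: (IH C) => //.
  - by rewrite /kset -(sstep_card s).
  - exact: path_sorted rw.
  - exact: path_sorted rw'.
  - by rewrite (sstep_fun s s').
have kB : kset B by rewrite /kset -(walk_card h).
have r : reducedw (winv (l :: w) ++ l' :: w').
  rewrite winv_cons; apply: reducedw_join => //.
    by rewrite -winv_cons reducedw_winv.
  by rewrite /nonback linvK eq_sym.
have : walk E B (winv (l :: w) ++ l' :: w') B.
  by apply/walk_cat; exists A => //; exact: walk_inv.
by move/(fE kB r); rewrite winv_cons; case: (winv w).
Qed.

(* If D is the diameter of the Om-orbit of A in its tree, all nontrivial geodesics
   from A to its translates start with the same letter, for otherwise two of them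
   would form a longer geodesic; moving A along this letter decreases D. *)
Lemma fixed_kset_aux (Om : {group T}) D A : kset A ->
  (forall t, t \in Om -> exists w, [/\ reducedw w, size w <= D & walk E A w (fa A t)]) ->
  exists2 B, conn E A B & forall t, t \in Om -> fa B t = B.
Proof.
elim: D A => [|D IH] A kA H.
  exists A; first exact: conn_refl.
  by move=> t /H[w [_]]; rewrite leqn0 size_eq0 => /eqP-> /= <-.
have [H'|] := pselect (forall t, t \in Om ->
    exists w, [/\ reducedw w, size w <= D & walk E A w (fa A t)]).
  exact: IH H'.
move/existsNP => [t0 /not_implyP[t0Om N0]].
have [[|l w0] [r0 s0 h0]] := H t0 t0Om.
  by case: N0; exists [::].
have {}s0 : size w0 = D.
  apply/eqP; rewrite eqn_leq; apply/andP; split; first exact: s0.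
  rewrite leqNgt; apply/negP => lt.
  by case: N0; exists (l :: w0); split=> //; apply: leq_trans lt _.
have first t m w : t \in Om -> reducedw (m :: w) ->
    walk E A (m :: w) (fa A t) -> m = l.
  move=> tOm rw h; apply/eqP; apply: contraT => ne.
  have r : reducedw (winv (m :: w) ++ l :: w0).
    rewrite winv_cons; apply: reducedw_join => //.
      by rewrite -winv_cons reducedw_winv.
    by rewrite /nonback linvK eq_sym.
  have h1 : walk E (fa A t) (winv (m :: w) ++ l :: w0) (fa A t0).
    by apply/walk_cat; exists A => //; exact: walk_inv.
  have := walk_act t^-1%g h1; rewrite faK -faM => h2.
  (* By uniqueness this long walk, translated by [t^-1], is the geodesic from [A] to its translate
     by [t0 * t^-1], whose length is at most [D.+1]. *)
  have [v [rv sv hv]] := H (t0 * t^-1)%g (groupM t0Om (groupVr tOm)).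
  have := walk_unique kA rv _ hv h2; rewrite reducedw_la => /(_ r) e.
  by move: sv; rewrite e size_map size_cat size_winv /= s0; lia.
have [B sB h0'] := h0.
suff [B' cB' fB'] : exists2 B', conn E B B' & forall t, t \in Om -> fa B' t = B'.
  by exists B' => //; apply: conn_trans cB'; exists [:: l], B.
apply: IH; first by rewrite /kset -(sstep_card sB).
move=> t tOm; have sBt := sstep_act t sB.
have [[|m w] [rw sw hw]] := H t tOm.
  (* Here [t] fixes [A], so it turns the geodesic for [t0] into one for [t0 * t], which also begins
     with [l]; thus [t] fixes [l] and hence [B]. *)
  have {}hw : A = fa A t := hw.
  have e : la l t = l.
    apply: (first (t0 * t)%g _ (map (la^~ t) w0)).
    - exact: groupM.
    - by have := reducedw_la t (l :: w0); rewrite r0.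
    - by have := walk_act t h0; rewrite -faM -hw.
  exists [::]; split=> //=; apply: (sstep_fun sB); rewrite -e.
  by move: sBt; rewrite -hw.
have em := first _ _ _ tOm rw hw; subst m.
(* The reversed geodesic, translated by [t^-1], also starts at [A] and hence with [l]. So both ends
   of the geodesic can be cut off, which leaves a walk from [B] to its translate. *)
have := walk_act t^-1%g (walk_inv hw); rewrite faK.
have := reducedw_winv (l :: w); rewrite rw -(reducedw_la t^-1%g).
case: (lastP w) rw sw hw => [|v n] rw sw [C sC hC].
  (* For a geodesic of length one, the inverse of [l] would be a translate of [l], but [T] preserves
     signs. *)
  move=> _ h; have := first _ (la (linv l) t^-1%g) [::] (groupVr tOm) isT h.
  by move/(congr1 snd) => /=; case: l.2.
rewrite -rcons_cons winv_rcons => r h.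
have e : linv n = la l t.
  by rewrite -(first _ _ _ (groupVr tOm) r h) -laM mulVg la1.
move: hC => /walk_rcons[F hF sF].
have eF : F = fa B t.
  by apply: (sstep_fun (sstep_sym sF)); rewrite e.
exists v; split.
- by move: rw; rewrite -rcons_cons -cats1 -cat1s => /reducedw_cat[/reducedw_cat[_]].
- by move: sw; rewrite /= size_rcons; lia.
- by rewrite -eF (sstep_fun sB sC).
Qed.

(** There are finitely many translates, so the orbit of [A] under the stabiliser of its component
    has bounded diameter and [fixed_kset_aux] applies. *)
Lemma fixed_kset A : kset A ->
  exists2 B, conn E A B & forall t, conn E A (fa A t) -> fa B t = B.
Proof.
move=> kA; pose Om := [set t : T | `[< conn E A (fa A t) >]]%SET.
have OmP t : reflect (conn E A (fa A t)) (t \in Om).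
  by rewrite finset.inE; exact: asboolP.
have gOm : group_set Om.
  apply/group_setP; split=> [|t u].
    by apply/OmP; rewrite fa1; exact: conn_refl.
  move=> /OmP h /OmP h'; apply/OmP; rewrite faM.
  exact: conn_trans h' (conn_act _ h).
have /choice[w wP] : forall t, exists w, t \in Om -> reducedw w /\ walk E A w (fa A t).
  move=> t; have [|_] := boolP (t \in Om); last by exists [::].
  by move=> /OmP[w /walk_reduce[v h]]; exists v.
have [|B cB fB] := @fixed_kset_aux (group gOm) (\max_t size (w t)) A kA.
  move=> t /wP[r h]; exists (w t); split=> //.
  exact: (leq_bigmax (F := fun t => size (w t))).
by exists B => // t ct; apply: fB; apply/OmP.
Qed.

End Pregraph.

(** * Forests as graphs without loops *)

(* A closed cyclically reduced walk, unrolled periodically. *)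
Definition loop (E : graph) := exists n (C : nat -> {fset pt}) (l : nat -> letter),
  [/\ 0 < n, forall i, C (i + n)%N = C i /\ l (i + n)%N = l i,
      forall i, sstep E (C i) (l i) (C i.+1),
      forall i, nonback (l i) (l i.+1) & kset (C 0)].

Lemma walk_vertices (E : graph) d A w B : walk E A w B -> exists f,
  [/\ f 0 = A, f (size w) = B &
      forall i, i < size w -> sstep E (f i) (nth d w i) (f i.+1)].
Proof.
elim: w A => [|l w IH] A /=; first by move=> e; exists (fun=> A).
move=> [C s /IH[f [f0 fn fs]]]; exists (fun i => if i is j.+1 then f j else A).
by split=> // -[|i] //=; [rewrite f0 | exact: fs].
Qed.

Lemma closed_walk_loop (E : graph) A l w : kset A -> reducedw (l :: w) ->
  nonback (last l w) l -> walk E A (l :: w) A -> loop E.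
Proof.
move=> kA rw ll /(walk_vertices l)[f [f0 fn fs]].
pose n := size (l :: w); pose m i := nth l (l :: w) (i %% n).
exists n, (fun i => f (i %% n)), m.
have modS i : i.+1 %% n = (i %% n).+1 \/ (i %% n).+1 = n /\ i.+1 %% n = 0.
  rewrite -addn1 -modnDml addn1; have : i %% n < n by rewrite ltn_mod.
  rewrite leq_eqVlt => /orP[/eqP e|lt]; first by right; rewrite e modnn.
  by left; rewrite modn_small.
have lt i : i %% n < n by rewrite ltn_mod.
split=> //.
- by move=> i; rewrite /m modnDr.
- move=> i; have := fs _ (lt i); rewrite -/(m i); case: (modS i) => [-> //|[e ->]].
  by rewrite e fn -f0.
- move=> i; rewrite /m; case: (modS i) => [e|[e ->]].
    rewrite e; move/(sortedP l): rw; apply; rewrite -e; exact: lt.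
  by rewrite /= -[i %% n]/((i %% n).+1.-1) e nth_last.
- by rewrite mod0n f0.
Qed.

(** Induction on the length. A reduced closed walk that is not cyclically reduced ends with the
    inverse of its first letter; cutting off both leaves a shorter one, empty by induction, and then
    the original was not reduced. *)
Lemma loop_forest (E : graph) : pregraph E -> ~ loop E -> forest E.
Proof.
move=> pE nl A w; have [n] := ubnP (size w).
elim: n A w => // n IH A [//|l w] /= sz kA rw h.
have [ll|] := boolP (nonback (last l w) l).
  by case: nl; exact: closed_walk_loop ll h.
case: (lastP w) sz rw h => [|v m] /= sz rw h.
  by rewrite negbK eq_sym (negPf (linv_neq l)).
rewrite last_rcons negbK => /eqP el; case: h => [C sC /walk_rcons[D h sD]].
have eD : D = C by apply: (sstep_fun pE (sstep_sym pE sD)); rewrite -el.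
have rv : reducedw v.
  by move/path_sorted: rw; rewrite -cats1 => /reducedw_cat[].
move: h; rewrite eD => /(IH _ _ _ _ rv) e.
by move: rw; rewrite e ?el /kset -?(sstep_card pE sC) //=
  ?/nonback ?linvK ?eqxx //; move: sz; rewrite size_rcons; lia.
Qed.

Lemma loop_walk (E : graph) (C : nat -> {fset pt}) (l : nat -> letter) i m :
  (forall j, i <= j < (i + m)%N -> sstep E (C j) (l j) (C j.+1)) ->
  walk E (C i) (map l (iota i m)) (C (i + m)%N).
Proof.
elim: m i => [|m IH] i st /=; first by rewrite addn0.
exists (C i.+1); first by apply: st; lia.
by rewrite addnS -addSn; apply: IH => j h; apply: st; lia.
Qed.

Lemma loop_reduced (l : nat -> letter) i m :
  (forall i, nonback (l i) (l i.+1)) -> reducedw (map l (iota i m)).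
Proof.
move=> nb; case: m => // m; rewrite /reducedw /=.
by elim: m i => //= m IH i; rewrite nb IH.
Qed.

Lemma forest_loop (E : graph) : forest E -> ~ loop E.
Proof.
move=> fE [n [C [l [n0 per st nb k0]]]].
have := @loop_walk E C l 0 n (fun j _ => st j); rewrite add0n; have [-> _] := per 0.
by move/(fE _ _ k0 (loop_reduced 0 n nb)); case: n n0 {per}.
Qed.

(** * Forced fixed points, bounds, and the initial graph *)

Lemma pa_fix x t : t != 1%g -> pa x t = x -> exists i, x = inl i.
Proof.
case: x => [i|[n u]]; first by exists i.
move=> /eqP t1 [/eqP]; rewrite -[X in _ == X]mulg1 (inj_eq (mulgI u)) => /eqP.
by move/t1.
Qed.

Lemma fixl_inl x s : fixl x s -> exists i, x = inl i.
Proof. by case=> t [/pa_fix h /h]. Qed.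

Lemma fixl_act x s t : fixl x s -> fixl (pa x t) (sa s t).
Proof.
case=> u [u1 ux us]; exists (u ^ t)%g; split.
- by rewrite conjg_eq1.
- by rewrite -paM -conjgC paM ux.
- by rewrite -saM -conjgC saM us.
Qed.

Lemma fixl_actE x s t : fixl (pa x t) (sa s t) <-> fixl x s.
Proof.
split; last exact: fixl_act.
by move/(fixl_act t^-1%g); rewrite paK -saM mulgV sa1.
Qed.

Lemma below_pa M x t : below M (pa x t) = below M x.
Proof. by case: x. Qed.

Lemma below_leq M N x : M <= N -> below M x -> below N x.
Proof. by case: x => // u MN /= h; apply: leq_trans MN. Qed.

Lemma exists_below (A : {fset pt}) : exists M, forall x, x \in A -> below M x.
Proof.
pose h (x : pt) := if x is inr u then u.1.+1 else 0.
exists (\max_(x <- A) h x) => x xA.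
have : h x <= \max_(y <- A) h y by exact: (@leq_bigmax_seq _ _ predT h x xA isT).
by case: x xA.
Qed.

Lemma short_leq E K N : K <= N -> short E K -> short E N.
Proof.
move=> KN sE x l y; rewrite -(subnKC KN) => /chain_split[z h _].
exact: sE h.
Qed.

Definition base : {fset pt} := [fset (inl i : pt) | i in I].

Lemma baseP i : (inl i : pt) \in base.
Proof. by apply/imfsetP; exists i. Qed.

Lemma card_base : kset base.
Proof. by rewrite /kset card_imfset ?cardE //; exact: inl_inj. Qed.

Lemma fa_base t : fa base t = base.
Proof.
apply/fsetP => x; rewrite in_fa; case: x => [i|u]; first by rewrite !baseP.
by apply/idP/idP => /imfsetP[].
Qed.

(* Otherwise all points of the base would be forced fixed points of s. *)
Hypothesis Sfree : forall s, exists i, forall t,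
  ia i t = i -> sa s t = s -> t = 1%g.

Definition E0 : graph := fun x l y => x = y /\ fixl x l.1.

(** No k-set admits a step: all its points would be forced fixed points of one letter, thus base
    points, but [Sfree] excludes some point of the base. *)
Lemma good_E0 : good E0.
Proof.
split; last 2 first.
- by exists 0 => x l y [_ /fixl_inl[i ->]].
- by exists 1 => x l y [z [_ h]].
split=> [|//|].
  split.
  - by move=> x l y t [-> h]; split=> //; exact: fixl_act.
  - by move=> x l y [-> h].
  - by move=> x l y y' [-> _] [-> _].
move=> A [//|l w] kA _ [C [s1 _] _].
have [i hi] := Sfree l.1.
have sub : A `<=` base `\ inl i.
  apply/fsubsetP => x /s1[y _ [_ fx]]; have [j e] := fixl_inl fx.
  rewrite e in_fsetD1 baseP andbT; apply/eqP => -[ej].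
  have [t [/eqP t1]] := fx; rewrite e ej => -[h1 h2].
  by case: t1; exact: hi.
have := fsubset_leq_card sub; rewrite kA.
by have := cardfsD1 (inl i : pt) base; rewrite baseP card_base => ->; rewrite add1n ltnn.
Qed.

(** * Extending a graph by leaves *)

(* E' is obtained from E by adding edges labelled in the T-orbit of l^{+-1} and
   leading to points that are not below M, without merging components. *)
Record extends M l (E E' : graph) : Prop := Extends {
  e_good : good E';
  e_sub : forall x m y, E x m y -> E' x m y;
  e_new : forall x m y, E' x m y -> ~ E x m y ->
    (exists t, m.1 = sa l.1 t) /\ (m.2 = l.2 -> ~~ below M y);
  e_conn : forall A B : {fset pt}, (forall x, x \in A -> below M x) ->
    (forall x, x \in B -> below M x) -> conn E' A B -> conn E A B }.

Lemma extends_refl M l E : good E -> extends M l E E.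
Proof. by move=> gE; split. Qed.

Lemma extends_trans M l E E' E'' :
  extends M l E E' -> extends M l E' E'' -> extends M l E E''.
Proof.
case=> g1 s1 n1 c1 [g2 s2 n2 c2]; split=> //.
- by move=> x m y /s1/s2.
- move=> x m y h nE; have [h1|h1] := pselect (E' x m y); first exact: (n1 _ _ _ h1 nE).
  exact: (n2 _ _ _ h h1).
- by move=> A B AM BM h; apply: c1 => //; exact: c2.
Qed.

Section Leaves.
Variables (E E' : graph) (F : pt -> Prop).
Hypotheses (gE : good E) (pE' : pregraph E')
  (sub : forall x m y, E x m y -> E' x m y)
  (old : forall x m y, E' x m y -> ~ F x -> ~ F y -> E x m y)
  (leaf : forall x m y m' y', F x -> E' x m y -> E' x m' y' -> m = m').

Lemma leaf_nonback x m y m' z : F y -> E' x m y -> E' y m' z -> ~~ nonback m m'.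
Proof.
move=> Fy /(g_sym pE') h h'; rewrite /nonback negbK.
by rewrite (leaf Fy h h').
Qed.

(** A point of [F] carries a single letter, so a set in the interior of a reduced walk contains
    none: the letters of arrival and departure would be inverse to each other. *)
Lemma leaf_walk A w B : (forall x, x \in A -> ~ F x) ->
  (forall x, x \in B -> ~ F x) -> reducedw w -> walk E' A w B -> walk E A w B.
Proof.
move=> + FB; elim: w A => //= l w IH A FA rw [C [s1 s2] h].
have FC y : y \in C -> ~ F y.
  move=> yC Fy; have [x xA xy] := s2 _ yC.
  case: w rw h {IH} => [_ /= e|m w /= /andP[lm _]].
    by apply: FB Fy; rewrite -e.
  by case=> D [/(_ _ yC)[z _ yz] _] _; move: lm; rewrite (negPf (leaf_nonback Fy xy yz)).
exists C.
  split=> x /[dup] xA => [/s1|/s2] [y yC xy]; exists y => //.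
    by apply: old xy _ _; [exact: FA | exact: FC].
  by apply: old xy _ _; [exact: FA | exact: FC].
by apply: IH => //; exact: path_sorted rw.
Qed.

Lemma leaf_forest : forest E'.
Proof.
apply: loop_forest => // -[n [C [l [n0 per st nb k0]]]].
have FS i y : y \in C i.+1 -> ~ F y.
  move=> yC Fy; have [_ /(_ _ yC)[x _ xy]] := st i.
  have [/(_ _ yC)[z _ yz] _] := st i.+1.
  by have := nb i; rewrite (negPf (leaf_nonback Fy xy yz)).
have FC i y : y \in C i -> ~ F y.
  have [<- _] := per i; case: n n0 {per} => // n _; rewrite addnS; exact: FS.
apply: (forest_loop (g_for gE)); exists n, C, l; split=> // i.
have [s1 s2] := st i.
split=> x /[dup] xA => [/s1|/s2] [y yC xy]; exists y => //.
  by apply: old xy _ _; [exact: FC xA | exact: FC yC].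
by apply: old xy _ _; [exact: FC yC | exact: FC xA].
Qed.

Lemma leaf_chain m n x y : ~ F x -> chain E' m n.+1 x y ->
  exists z, chain E m n x z.
Proof.
elim: n x => [|n IH] x Fx; first by exists x.
case=> u xu /[dup] h [v uv _].
have Fu : ~ F u.
  move=> Fu; have := leaf_nonback Fu xu uv.
  by rewrite /nonback negbK eq_sym (negPf (linv_neq m)).
have [z uz] := IH _ Fu h; exists z, u => //; exact: old xu Fx Fu.
Qed.

End Leaves.

(** If no edge leaves [x] with letter [l], the pair of [x] and [l] has trivial stabiliser, as
    otherwise the forced loop would be present. A fresh regular orbit can thus be attached
    equivariantly, as leaves. *)
Lemma extend_leaf E M x l : good E ->
  exists2 E', extends M l E E' & exists y, E' x l y.
Proof.
move=> gE; have [ex|nex] := pselect (exists y, E x l y).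
  by exists E => //; exact: extends_refl.
have nfx : ~ fixl x l.1 by move=> h; apply: nex; exists x; exact: (g_loop gE).
have [N0 bN0] := g_bd gE.
have [N [MN N0N xN]] : exists N, [/\ M <= N, N0 <= N & below N x].
  exists (maxn (maxn M N0) (if x is inr u then u.1.+1 else 0)).
  split; [lia|lia|case: (x) => //= u; lia].
have bN y m z : E y m z -> below N y by move/bN0; exact: below_leq.
pose y t : pt := inr (N, t).
have yN t : below N (y t) = false by rewrite /= ltnn.
have yI t u : y t = y u -> t = u by case.
have yA t u : pa (y t) u = y (t * u)%g by [].
have xI t u : pa x t = pa x u -> sa l.1 t = sa l.1 u -> t = u.
  move=> e1 e2; apply/eqP; rewrite eq_mulgV1; apply: contraT => ne.
  case: nfx; exists (t * u^-1)%g; split=> //.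
    by rewrite paM e1 paK.
  by rewrite saM e2 -saM mulgV sa1.
pose new p m q := exists t, [/\ p = pa x t, m = la l t & q = y t].
pose E' : graph := fun p m q => [\/ E p m q, new p m q | new q (linv m) p].
have pE' : pregraph E'.
  split.
  - move=> p m q t [h|[u [-> -> ->]]|[u [-> em ->]]].
    + by constructor 1; exact: (g_eq gE).
    + by constructor 2; exists (u * t)%g; rewrite paM laM.
    + by constructor 3; exists (u * t)%g; rewrite paM laM -la_linv em.
  - move=> p m q [h|h|h].
    + by constructor 1; exact: (g_sym gE).
    + by constructor 3; rewrite linvK.
    + by constructor 2.
  - have aux p m q q' : E p m q -> new p m q' \/ new q' (linv m) p -> q = q'.
      move=> h [[t [e1 e2 e3]]|[t [_ _ e3]]].
        case: nex; exists (pa q t^-1%g); have := g_eq gE t^-1%g h.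
        by rewrite e1 e2 paK laK.
      by move: h => /bN; rewrite e3 yN.
    move=> p m q q' [h|h|h] [h'|h'|h'].
    + exact: (g_fun gE h h').
    + by apply: aux h _; left.
    + by apply: aux h _; right.
    + by apply/esym; apply: aux h' _; left.
    + case: h h' => t [-> -> ->] [u [e1 [e2] ->]].
      by rewrite (xI _ _ e1 e2).
    + case: h h' => t [-> _ ->] [u [_ _ e]].
      by have := below_pa N x t; rewrite xN e yN.
    + by apply/esym; apply: aux h' _; right.
    + case: h' h => t [-> _ ->] [u [_ _ e]].
      by have := below_pa N x t; rewrite xN e yN.
    + by case: h h' => t [-> _ ->] [u [-> _ /yI->]].
pose F p := exists t, p = y t.
have Fb p : F p -> ~~ below N p by case=> t ->; rewrite yN.
have sub p m q : E p m q -> E' p m q by constructor 1.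
have old p m q : E' p m q -> ~ F p -> ~ F q -> E p m q.
  move=> [//|[t [_ _ ->]] _ []|[t [_ _ ->]] []]; by exists t.
have leaf0 p m q : F p -> E' p m q -> new q (linv m) p.
  move=> [t ->] [/bN|[u [e _ _]]|//]; first by rewrite yN.
  by have := below_pa N x u; rewrite xN -e yN.
have leaf p m q m' q' : F p -> E' p m q -> E' p m' q' -> m = m'.
  move=> Fp h h'; have [t [_ e1 ep]] := leaf0 _ _ _ Fp h.
  have [u [_ e2]] := leaf0 _ _ _ Fp h'; rewrite ep => /yI e3.
  by rewrite -(linvK m) -(linvK m') e1 e2 e3.
have fE' := leaf_forest gE pE' old leaf.
exists E'; last by exists (y 1%g); constructor 2; exists 1%g; rewrite pa1 la1.
have [K sK] := g_short gE.
split=> //.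
- split.
  + by split=> // p m /(g_loop gE); constructor 1.
  + exists N.+1 => p m q [/bN/below_leq->//|[t [-> _ _]]|[t [_ _ ->]]].
      by rewrite below_pa; exact: below_leq xN.
    by rewrite /= ltnSn.
  (* Only the first and the last step of a chain can use new edges. *)
  + exists K.+2 => p m q; have [Fp|nFp] := pselect (F p).
      case=> z pz; have [t [ez em ep]] := leaf0 _ _ _ Fp pz.
      have nFz : ~ F z by move/Fb; rewrite ez below_pa xN.
      case/(leaf_chain pE' old leaf nFz) => v /sK.
      by move: em => /(congr1 fst) /= ->; rewrite ez fixl_actE.
    by case/(leaf_chain pE' old leaf nFp) => v; apply: short_leq sK _ _ _.
- move=> p m q [//|[t [_ -> ->]] _|[t [_ em _]] _].
    by split; [exists t | rewrite /y /= -leqNgt].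
  split; first by exists t; move: em => /(congr1 fst).
  by move: em => /(congr1 snd) /= <-; case: m.2.
- move=> A B AM BM [w /(walk_reduce pE')[v [rv h]]]; exists v.
  apply: (leaf_walk pE' old leaf _ _ rv h) => z.
    by move=> /AM/(below_leq MN) bz /Fb; rewrite bz.
  by move=> /BM/(below_leq MN) bz /Fb; rewrite bz.
Qed.

Lemma extend_seq E M (s : seq pt) l : good E ->
  exists2 E', extends M l E E' & forall x, x \in s -> exists y, E' x l y.
Proof.
elim: s E => [|x s IH] E gE; first by exists E => //; exact: extends_refl.
have [E1 ex1 [y xy]] := extend_leaf M x l gE.
have [E2 ex2 h2] := IH _ (e_good ex1); exists E2; first exact: extends_trans ex1 ex2.
move=> z; rewrite inE => /orP[/eqP->|/h2 //]; exists y; exact: (e_sub ex2 xy).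
Qed.

Lemma sstep_total (E : graph) (A : {fset pt}) l :
  (forall x, x \in A -> exists y, E x l y) -> exists B, sstep E A l B.
Proof.
move=> H; have /choice[f fP] : forall x : pt, exists y, x \in A -> E x l y.
  move=> x; have [xA|] := boolP (x \in A); last by exists x.
  by have [y] := H _ xA; exists y.
exists [fset f x | x in A]; split=> [x xA|y /imfsetP[x /= xA ->]].
  by exists (f x); [exact: in_imfset | exact: fP].
by exists x => //; exact: fP.
Qed.

Lemma extend_walk E M (A : {fset pt}) l n : good E ->
  exists2 E', extends M l E E' & exists B, walk E' A (nseq n l) B.
Proof.
elim: n E A => [|n IH] E A gE.
  by exists E; [exact: extends_refl | exists A].
have [E1 ex1 /sstep_total[B sB]] := extend_seq M A l gE.
have [E2 ex2 [C hC]] := IH _ B (e_good ex1).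
exists E2; first exact: extends_trans ex1 ex2.
exists C => /=; exists B => //.
by case: sB => s1 s2; split=> x => [/s1|/s2] [y yC /(e_sub ex2)]; exists y.
Qed.

(** * Joining two components by bridges *)

(* side false and side true are Om-invariant k-sets with the same non-free part;
   the representatives e false j and e true j of their free Om-orbits are joined by
   a path of L fresh edges labelled r, and this is extended by equivariance. *)
Section Closing.
Local Open Scope nat_scope.
Variables (E : graph) (gE : good E) (K M p : nat) (Om : {group T}) (r : S).
Variables (e : bool -> nat -> pt) (side : bool -> {fset pt}).
Hypotheses (shE : short E K) (bdE : bounded E M)
  (Omr : forall t, t \in Om <-> sa r t = r)
  (sideP : forall c x, x \in side c <->
     fixl x r \/ exists j t, [/\ j < p, t \in Om & x = pa (e c j) t])
  (e_inj : forall c j j' t, j < p -> j' < p -> t \in Om ->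
     e c j = pa (e c j') t -> j = j' /\ t = 1%g)
  (e_disj : forall j j' t, j < p -> j' < p -> t \in Om ->
     e false j <> pa (e true j') t)
  (e_free : forall c j t c' y, j < p -> ~ E (e c j) (sa r t, c') y)
  (e_below : forall c j, j < p -> below M (e c j))
  (side_kset : forall c, kset (side c))
  (side_stab : forall t, conn E (side false) (fa (side false) t) -> t \in Om)
  (side_conn : forall t, ~ conn E (side false) (fa (side true) t)).

(** A single letter has no old chain of this length except from forced fixed points; the successor
    also keeps the length positive. *)
Let L := K.+1.

(** Inner vertices are taken in fresh regular orbits; for [0 < i < L] the number [j * L + i]
    determines [j] and [i]. *)
Definition vertex j i : pt :=
  if i == 0 then e false j else if i == L then e true j
  else inr (M + (j * L + i), 1%g).

(* The i-th vertex of the j-th path, read from side c. *)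
Definition vtx (c : bool) j i := vertex j (if c then L - i else i).

(** The sign [c] of the letter is the side from which the path is read, so both orientations of an
    edge have this form. *)
Definition bridge x l y := exists c j i t, [/\ j < p, i < L,
  x = pa (vtx c j i) t, l = (sa r t, c) & y = pa (vtx c j i.+1) t].

Definition bridged : graph := fun x l y => E x l y \/ bridge x l y.

Lemma vtx0 c j : vtx c j 0 = e c j.
Proof. by rewrite /vtx /vertex; case: c; rewrite //= subn0 eqxx. Qed.

Lemma vtxL c j : vtx c j L = e (~~ c) j.
Proof. by rewrite /vtx /vertex subnn; case: c; rewrite //= eqxx. Qed.

Lemma vtx_rev c j i : i <= L -> vtx c j i = vtx (~~ c) j (L - i).
Proof. by rewrite /vtx; case: c => // h; rewrite subKn. Qed.

Lemma vertex_mid j i : 0 < i < L -> vertex j i = inr (M + (j * L + i), 1%g).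
Proof.
case/andP=> i0 iL; rewrite /vertex.
by rewrite (negPf (lt0n_neq0 i0)) (ltn_eqF iL).
Qed.

Lemma posP i : i <= L -> [\/ i = 0, i = L | 0 < i < L].
Proof.
move=> iL; case: (posnP i) => [->|i0]; first by constructor 1.
move: iL; rewrite leq_eqVlt => /orP[/eqP->|iL]; first by constructor 2.
by constructor 3; apply/andP.
Qed.

Lemma mid_inj j j' i i' : 0 < i < L -> 0 < i' < L ->
  M + (j * L + i) = M + (j' * L + i') -> j = j' /\ i = i'.
Proof.
move=> /andP[_ iL] /andP[_ iL'] /addnI eq.
have := congr1 (divn^~ L) eq; rewrite !divnMDl // !divn_small // !addn0 => ej.
by split=> //; move: eq; rewrite ej => /addnI.
Qed.

Lemma vertex_inj j j' i i' t : j < p -> j' < p -> i <= L -> i' <= L ->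
  t \in Om -> vertex j i = pa (vertex j' i') t -> [/\ j = j', i = i' & t = 1%g].
Proof.
move=> jp jp' /posP hi /posP hi' tO.
have v0 k : vertex k 0 = e false k by [].
have vL k : vertex k L = e true k by rewrite /vertex /= eqxx.
have nb c k n u v : k < p -> pa (e c k) u = inr (M + n, v) -> False.
  by move=> kp h; have := e_below c kp; rewrite -(below_pa M _ u) h /=; lia.
have nb' c k n v : k < p -> e c k = inr (M + n, v) -> False.
  by move=> kp h; apply: (nb c k n 1%g v kp); rewrite pa1.
case: hi => [->|->|hi]; case: hi' => [->|->|hi'];
  rewrite ?v0 ?vL ?(vertex_mid _ hi) ?(vertex_mid _ hi') //=.
- by move/(e_inj jp jp' tO) => [-> ->].
- by move/(e_disj jp jp' tO).
- by move/(nb' _ _ _ _ jp).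
- move=> h; have := e_disj jp' jp (groupVr tO).
  by rewrite h paK.
- by move/(e_inj jp jp' tO) => [-> ->].
- by move/(nb' _ _ _ _ jp).
- by move/esym/(nb _ _ _ _ _ jp').
- by move/esym/(nb _ _ _ _ _ jp').
- by rewrite mul1g => -[/(mid_inj hi hi')[-> ->] <-].
Qed.

Lemma vtx_inj c j j' i i' t : j < p -> j' < p -> i <= L -> i' <= L ->
  t \in Om -> vtx c j i = pa (vtx c j' i') t -> [/\ j = j', i = i' & t = 1%g].
Proof.
move=> jp jp' iL iL' tO; rewrite /vtx => /(vertex_inj jp jp' _ _ tO)[||->].
- by case: c; lia.
- by case: c; lia.
- by move=> h ->; split=> //; case: c h; lia.
Qed.

Lemma sa_Om t u : sa r t = sa r u -> (u * t^-1)%g \in Om.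
Proof. by move=> h; apply/Omr; rewrite saM -h -saM mulgV sa1. Qed.

Lemma vtx_act_inj c j j' i i' t u : j < p -> j' < p -> i <= L -> i' <= L ->
  sa r t = sa r u -> pa (vtx c j i) t = pa (vtx c j' i') u ->
  [/\ j = j', i = i' & t = u].
Proof.
move=> jp jp' iL iL' /sa_Om h /(congr1 (pa^~ t^-1%g)); rewrite paK -paM.
move/(vtx_inj jp jp' iL iL' h) => [-> ->] /(canRL (mulgKV _)).
by rewrite mul1g => ->.
Qed.

(** The ends are covered by [e_free]; inner vertices are not below [M], whereas old edges start
    below it. *)
Lemma vtx_old c j i t u c' y : j < p -> i <= L ->
  ~ E (pa (vtx c j i) t) (sa r u, c') y.
Proof.
move=> jp iL h.
have ends d v y' : ~ E (pa (e d j) t) (sa r v, c') y'.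
  move/(g_eq gE t^-1%g); rewrite paK /la /= -saM; exact: e_free.
case: (posP iL) h => [->|->|{}iL]; rewrite ?vtx0 ?vtxL; try exact: ends.
rewrite /vtx vertex_mid; last by case: c; lia.
by move/bdE => /=; lia.
Qed.

Lemma bridged_pre : pregraph bridged.
Proof.
have symb x l y : bridge x l y -> bridge y (linv l) x.
  move=> [c [j [i [t [jp iL -> -> ->]]]]]; exists (~~ c), j, (L - i.+1), t.
  split=> //; first lia.
    by rewrite (vtx_rev c j iL).
  by rewrite (vtx_rev c j (ltnW iL)) -subSn.
split.
- move=> x l y t [h|[c [j [i [u [jp iL -> -> ->]]]]]].
    by left; exact: (g_eq gE).
  right; exists c, j, i, (u * t)%g.
  by rewrite !paM /la /= saM.
- by move=> x l y [/(g_sym gE)|/symb]; [left|right].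
- move=> x l y y' [h|h] [h'|h'].
  + exact: g_fun gE _ _ _ _ h h'.
  + case: h' h => c [j [i [t [jp iL -> -> _]]]].
    by move/(vtx_old jp (ltnW iL)).
  + case: h h' => c [j [i [t [jp iL -> -> _]]]].
    by move/(vtx_old jp (ltnW iL)).
  + case: h h' => c [j [i [t [jp iL -> -> ->]]]].
    move=> [c' [j' [i' [t' [jp' iL' ex [el ec] ->]]]]].
    rewrite -ec in ex *.
    by have [-> -> ->] := vtx_act_inj jp jp' (ltnW iL) (ltnW iL') el ex.
Qed.

Lemma bridged_step c j i t : j < p -> i < L ->
  bridged (pa (vtx c j i) t) (sa r t, c) (pa (vtx c j i.+1) t).
Proof. by move=> jp iL; right; exists c, j, i, t. Qed.

Lemma bridged_stepE c j i t y : j < p -> i < L ->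
  bridged (pa (vtx c j i) t) (sa r t, c) y -> y = pa (vtx c j i.+1) t.
Proof. by move=> jp iL h; apply: g_fun bridged_pre _ _ _ _ h _; exact: bridged_step. Qed.

Lemma bridged_end c j t y : j < p -> ~ bridged (pa (vtx c j L) t) (sa r t, c) y.
Proof.
move=> jp [/vtx_old|[c' [j' [i' [t' [jp' iL' ex [el ec] _]]]]]]; first exact.
rewrite -ec in ex.
have [_ eL _] := vtx_act_inj jp jp' (leqnn L) (ltnW iL') el ex.
by rewrite -eL ltnn in iL'.
Qed.

Lemma bridged_follow c j i t m y : j < p -> i <= L ->
  chain bridged (sa r t, c) m (pa (vtx c j i) t) y -> i + m <= L.
Proof.
move=> jp; elim: m i => [|m IH] i iL /=; first by rewrite addn0.
case=> z; move: iL; rewrite leq_eqVlt => /orP[/eqP->|iL].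
  by move/(bridged_end jp).
by move/(bridged_stepE jp iL) => -> /(IH _ iL); rewrite addnS addSn.
Qed.

(** A point reached by an old edge has an old edge for the inverse letter, so by [vtx_old] it is no
    path vertex and the next step is old again. *)
Lemma bridged_old u c m x z y : E z (sa r u, c) x ->
  chain bridged (sa r u, c) m x y -> chain E (sa r u, c) m x y.
Proof.
elim: m z x => //= m IH z x zx [v [xv|]].
  by move/(IH _ _ xv); exists v.
move=> [c' [j [i [t [jp iL ex _ _]]]]] _; have := g_sym gE zx.
by rewrite ex => /(vtx_old jp (ltnW iL)).
Qed.

(** A chain beginning with an old edge is old throughout, hence too long unless it starts at a
    forced fixed point. One beginning with a new edge must follow its path, which has room for [L]
    steps only from its end. *)
Lemma bridged_chain u c x y : chain bridged (sa r u, c) L x y ->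
  fixl x (sa r u) \/
  exists j t, [/\ j < p, sa r t = sa r u & x = pa (e c j) t].
Proof.
case=> z [xz|].
  move=> /(bridged_old xz) h; left.
  by apply: (short_leq (leqnSn K) shE (x := x) (l := (sa r u, c)) (y := y)); exists z.
move=> [d [j [i [t [jp iL -> [eu <-] ->]]]]]; rewrite eu => h; right.
have := bridged_follow jp iL h; rewrite addSnnS => iL0.
have {}iL0 : i = 0 by move: iL0; rewrite /L; lia.
by exists j, t; rewrite iL0 vtx0.
Qed.

(** For a letter in the orbit of [r], a chain of this length starting at a path end would run past
    the other end; other letters have no new edges. *)
Lemma bridged_good_short : short bridged L.+1.
Proof.
move=> x [s c] y h; have [[u su]|ns] := pselect (exists u, s = sa r u).
  move: h; rewrite su -addn1 => /chain_split[z h [z' zz' _]] /=.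
  have [//|[j [t [jp et ex]]]] := bridged_chain h.
  have : chain bridged (sa r t, c) L.+1 (pa (vtx c j 0) t) z'.
    rewrite vtx0 -ex et -addn1; apply: chain_cat h _.
    by exists z'.
  by move/(bridged_follow jp (leq0n _)); rewrite ltnn.
apply: (short_leq (_ : K <= L.+1) shE (x := x) (l := (s, c)) (y := y)).
  by rewrite /L; lia.
elim: L.+1 x h => //= m IH x [z [xz|]]; first by exists z; [|exact: IH].
by move=> [c' [j [i [t [_ _ _ [es _] _]]]]]; case: ns; exists t.
Qed.

Lemma side_act c t : t \in Om -> fa (side c) t = side c.
Proof.
move=> tO; apply/eqP; rewrite eqEfcard card_fa leqnn andbT.
apply/fsubsetP => _ /faP[x /sideP xs ->]; apply/sideP.
case: xs => [fx|[j [u [jp uO ->]]]]; [left|right].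
  by have := fixl_act t fx; rewrite (Omr t).1.
by exists j, (u * t)%g; rewrite paM groupM.
Qed.

(** [bridged_chain] puts each point of [X] into the translated side, and the cardinalities agree. So
    only translates of a side can follow the paths from end to end. *)
Lemma bridged_full X u c Y : kset X -> walk bridged X (nseq L (sa r u, c)) Y ->
  X = fa (side c) u.
Proof.
move=> kX /chain_sstep h; apply/eqP.
rewrite eqEfcard card_fa side_kset kX leqnn andbT; apply/fsubsetP => x /h[y _].
move/bridged_chain => hx; rewrite in_fa; apply/sideP.
case: hx => [fx|[j [t [jp et ->]]]]; [left|right].
  by apply/(fixl_actE _ _ u); rewrite paKV.
exists j, (t * u^-1)%g; split=> //; last by rewrite paM.
by apply: sa_Om.
Qed.

Lemma side_below c x t : x \in fa (side c) t -> below M x.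
Proof.
case/faP => y /sideP[/fixl_inl[i ->]|[j [u [jp _ ->]]]] -> //.
by rewrite !below_pa e_below.
Qed.

(** * Absence of loops in the bridged graph *)

Section Loop.
Variables (n : nat) (C : nat -> {fset pt}) (l : nat -> letter).
Hypotheses (n0 : 0 < n) (per : forall i, C (i + n) = C i /\ l (i + n) = l i)
  (st : forall i, sstep bridged (C i) (l i) (C i.+1))
  (nb : forall i, nonback (l i) (l i.+1)) (k0 : kset (C 0)).

(** The letter of the last step, at time [t0 + K], is kept in order to rule out an immediate
    return. *)
Definition crossing t0 c t :=
  [/\ C t0 = fa (side c) t, C (t0 + L) = fa (side (~~ c)) t,
      l t0 = (sa r t, c) & l (t0 + K) = (sa r t, c)].

Lemma loop_kset i : kset (C i).
Proof.
elim: i => // i IH; rewrite /kset -IH; apply/esym.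
exact: (sstep_card bridged_pre (st i)).
Qed.

Lemma perm m i : C (i + m * n) = C i /\ l (i + m * n) = l i.
Proof.
elim: m => [|m IH]; first by rewrite mul0n addn0.
by rewrite mulSn addnCA addnC; have [-> ->] := per (i + m * n).
Qed.

(** Inner vertices have degree two, since they are not below [M] and old edges start below it. *)
Lemma mid_out c j i t m y : j < p -> 0 < i < L ->
  bridged (pa (vtx c j i) t) m y ->
  m = (sa r t, c) /\ y = pa (vtx c j i.+1) t \/
  m = (sa r t, ~~ c) /\ y = pa (vtx c j i.-1) t.
Proof.
move=> jp ii; have mid d k h : 0 < h < L ->
    vtx d k h = inr (M + (k * L + if d then L - h else h), 1%g).
  by move=> hh; rewrite /vtx vertex_mid //; case: d; lia.
case=> [/bdE|]; first by rewrite (mid _ _ _ ii) /=; lia.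
move=> [c' [j' [i' [t' [jp' iL' ex -> ->]]]]].
have i0' : 0 < i'.
  rewrite lt0n; apply/eqP => e0; move: ex; rewrite e0 vtx0 => ex.
  by have := e_below c' jp'; rewrite -(below_pa M _ t') -ex (mid _ _ _ ii) /=; lia.
have ii' : 0 < i' < L by apply/andP.
move: ex; rewrite (mid _ _ _ ii') (mid _ _ _ ii) /= !mul1g => -[em <-].
have [||ej ep] := @mid_inj j j' (if c then L - i else i) (if c' then L - i' else i') _ _ em.
- by case: c {em}; lia.
- by case: c' {em}; lia.
rewrite -ej; case: c c' ep {em} => -[] ep.
- by left; split=> //; congr (pa (vtx _ _ _) _); lia.
- by right; split=> //; rewrite (vtx_rev true) /=; [congr (pa (vtx _ _ _) _)|]; lia.
- by right; split=> //; rewrite (vtx_rev false) /=; [congr (pa (vtx _ _ _) _)|]; lia.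
- by left; split=> //; congr (pa (vtx _ _ _) _); lia.
Qed.

(** At an inner vertex the only way not to turn back is to continue along the path, so the loop
    keeps reading the same letter. *)
Lemma loop_forward t0 c j t i : j < p -> i < L ->
  pa (vtx c j 0) t \in C t0 -> l t0 = (sa r t, c) ->
  pa (vtx c j i) t \in C (t0 + i) /\ l (t0 + i) = (sa r t, c).
Proof.
move=> jp; elim: i => [|i IH] iL h hl; first by rewrite addn0.
have [hi li] := IH (ltnW iL) h hl.
have hi1 : pa (vtx c j i.+1) t \in C (t0 + i.+1).
  have [/(_ _ hi)[y yC]] := st (t0 + i).
  by rewrite li => /(bridged_stepE jp (ltnW iL)) <- _; rewrite addnS.
split=> //; have [/(_ _ hi1)[y _]] := st (t0 + i.+1).
case/(mid_out jp); rewrite ?iL // => -[e1 _] _ //.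
by have := nb (t0 + i); rewrite li -addnS e1 /nonback eqxx.
Qed.

(** The same argument in reversed time; [i <= t0] leaves room for going back. *)
Lemma loop_backward c j t i t0 : j < p -> i < L -> i <= t0 ->
  pa (vtx c j i) t \in C t0 -> l t0 = (sa r t, c) ->
  exists t1, pa (vtx c j 0) t \in C t1 /\ l t1 = (sa r t, c).
Proof.
move=> jp; elim: i t0 => [|i IH] [|t0] // iL it0 h hl; try by exists 0.
  by exists t0.+1.
have [_ /(_ _ h)[x xC /(g_sym bridged_pre)]] := st t0.
case/(mid_out jp); rewrite ?iL // => -[e1 e2].
  by have := nb t0; rewrite hl -e1 /nonback eqxx.
apply: (IH t0) => //; first exact: ltnW.
  by move: e2 xC => /= ->.
by rewrite -(linvK (l t0)) e1 /linv /= negbK.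
Qed.

Lemma loop_crossing t0 c j t : j < p -> pa (vtx c j 0) t \in C t0 ->
  l t0 = (sa r t, c) -> crossing t0 c t.
Proof.
move=> jp h hl; have fw i iL := @loop_forward t0 c j t i jp iL h hl.
have w : walk bridged (C t0) (nseq L (sa r t, c)) (C (t0 + L)).
  have := @loop_walk bridged C l t0 L (fun i _ => st i); congr walk.
  apply: (@eq_from_nth _ (sa r t, c)); first by rewrite size_map size_iota size_nseq.
  move=> i; rewrite size_map size_iota => iL; rewrite nth_nseq iL.
  by rewrite (nth_map 0) ?size_iota // nth_iota // (fw _ iL).2.
have w' : walk bridged (C (t0 + L)) (nseq L (sa r t, ~~ c)) (C t0).
  by have := walk_inv bridged_pre w; rewrite /winv map_nseq rev_nseq.
split=> //.
- exact: (bridged_full (loop_kset _) w).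
- exact: (bridged_full (loop_kset _) w').
- exact: (fw K (ltnSn K)).2.
Qed.

Definition old_step i := sstep E (C i) (l i) (C i.+1).

Lemma new_step i : ~ old_step i -> exists c j i' t,
  [/\ j < p, i' < L, pa (vtx c j i') t \in C i & l i = (sa r t, c)].
Proof.
move=> nold; apply: contrapT => no; apply: nold.
have aux x y : x \in C i -> bridged x (l i) y -> E x (l i) y.
  move=> xC [//|[c [j [i' [t [jp iL ex el _]]]]]]; case: no.
  by exists c, j, i', t; rewrite -ex.
have [s1 s2] := st i; split=> x /[dup] xC => [/s1|/s2] [y yC xy];
  by exists y => //; apply: aux.
Qed.

Lemma exists_new : exists i, ~ old_step i.
Proof.
apply: contrapT => /forallNP h; apply: (forest_loop (g_for gE)).
by exists n, C, l; split=> // i; apply: contrapT; exact: h.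
Qed.

(** The first new step from time [t0] on starts at a path end: the sets met until then are below
    [M], and inner path vertices are not. *)
Lemma next_crossing t0 c u : C t0 = fa (side c) u -> exists t1 c1 u1,
  [/\ t0 <= t1, crossing t1 c1 u1 &
      walk E (C t0) (map l (iota t0 (t1 - t0))) (C t1)].
Proof.
move=> e0; have [i0 ni0] := exists_new.
have exN : exists i, (t0 <= i) && `[< ~ old_step i >].
  (* Adding [t0] periods moves a new step past time [t0]. *)
  exists (i0 + t0 * n); apply/andP; split; first by nia.
  apply/asboolP; rewrite /old_step -addSn.
  by have [-> ->] := perm t0 i0; have [-> _] := perm t0 i0.+1.
case: (ex_minnP exN) => t1 /andP[t01 /asboolP n1] min1.
have old i : t0 <= i < t1 -> old_step i.
  move=> /andP[ti it]; apply: contrapT => /asboolP ni.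
  by have := min1 i; rewrite ti ni => /(_ isT); rewrite leqNgt it.
have [c1 [j [i [u1 [jp iL h hl]]]]] := new_step n1.
have bel : below M (pa (vtx c1 j i) u1).
  move: t01; rewrite leq_eqVlt => /orP[/eqP et|lt].
    by move: h; rewrite -et e0; exact: side_below.
  case: t1 lt old h {min1 n1 hl} => // t1 lt old h.
  have ht : t0 <= t1 < t1.+1 by lia.
  have [_ /(_ _ h)[x _ /(g_sym gE)]] := old t1 ht.
  exact: bdE.
have iz : i = 0.
  case: (posnP i) => // ip; move: bel; rewrite below_pa /vtx vertex_mid /=; last first.
    by case: c1 {h hl}; lia.
  by case: c1 {h hl}; lia.
exists t1, c1, u1; split=> //.
  by apply: (loop_crossing jp _ hl); rewrite iz in h.
have := @loop_walk E C l t0 (t1 - t0); rewrite subnKC //; apply => k hk.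
exact: old.
Qed.

(* After crossing into a translate of side false, a loop could leave its component
   only through the edge it came from. *)
Lemma no_crossing_back t0 t : crossing t0 true t -> False.
Proof.
move=> [e0 /= e1 l0 l1].
have [t1 [c1 [u [t01 [f0 f1 m0 m1] w]]]] := next_crossing e1.
have c1F : c1 = false.
  apply/negbTE/negP => c1T.
  apply: (side_conn (t := (u * t^-1)%g)); move: w; rewrite e1 f0 c1T => w.
  by rewrite -[side false](faK t) faM; apply: (conn_act gE); eexists; exact: w.
rewrite c1F in f0 f1 m0 m1.
have uO : (u * t^-1)%g \in Om.
  apply: side_stab; move: w; rewrite e1 f0 => w.
  by rewrite -[X in conn E X](faK t) faM; apply: (conn_act gE); eexists; exact: w.
have ut : sa r t = sa r u by rewrite -[in RHS](mulgKV t u) saM ((Omr _).1 uO).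
have fu : fa (side false) u = fa (side false) t.
  by rewrite -[in LHS](mulgKV t u) faM side_act.
have kX : kset (fa (side false) t) by rewrite /kset card_fa side_kset.
(* The old walk between the two crossings is reduced and closed in a forest, so it is empty and the
   next letter undoes the last one. *)
move: w; rewrite e1 f0 fu => /(g_for gE kX (loop_reduced _ _ nb)).
move/(congr1 size); rewrite size_map size_iota => /eqP; rewrite subn_eq0 => le.
have {le} et : t1 = (t0 + K).+1 by rewrite -addnS; apply/eqP; rewrite eqn_leq le.
by have := nb (t0 + K); rewrite -et m0 l1 /nonback /linv /= ut eqxx.
Qed.

(** By [no_crossing_back] each crossing starts in a translate of [side false] and so ends in one of
    [side true]; the old walk to the next crossing then joins translates of both sides, contrary to
    [side_conn]. *)
Lemma loop_absurd : False.
Proof.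
have [i0 ni0] := exists_new.
have [c [j [i [t [jp iL h hl]]]]] := new_step ni0.
(* Shifting by [i] periods leaves room to trace the path back to its end. *)
have [Ci li] := perm i i0.
have [|||t0 [h0 hl0]] := @loop_backward c j t i (i0 + i * n) jp iL.
- by nia.
- by rewrite Ci.
- by rewrite li.
have cr := loop_crossing jp h0 hl0.
case: c {h hl h0 hl0} cr => [/no_crossing_back //|[_ /= e1 _ _]].
have [t1 [c1 [u [_ cr w]]]] := next_crossing e1.
case: c1 cr => [/no_crossing_back //|[f0 _ _ _]].
apply: (side_conn (t := (t * u^-1)%g)); move: w; rewrite e1 f0 => w.
rewrite -[side false](faK u) faM; apply: (conn_act gE).
by apply: (conn_sym gE); eexists; exact: w.
Qed.

End Loop.

Lemma bridged_good : good bridged.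
Proof.
split; last by exists L.+1; exact: bridged_good_short.
  split; first exact: bridged_pre.
  - by move=> x l h; left; exact: (g_loop gE).
  - apply: (loop_forest bridged_pre) => -[n [C [l [n0 per st nb k0]]]].
    exact: (loop_absurd n0 per st nb k0).
exists (M + (p * L + L)) => x l y [/bdE|]; first by apply: below_leq; lia.
move=> [c [j [i [t [jp iL -> _ _]]]]]; rewrite below_pa.
case: (posP (ltnW iL)) => [->|->|h].
- by rewrite vtx0; apply: below_leq (e_below c jp); lia.
- by rewrite vtxL; apply: below_leq (e_below (~~ c) jp); lia.
by rewrite /vtx vertex_mid /=; case: c; nia.
Qed.

(** Reading [r] repeatedly keeps forced fixed points in place and moves the other points
    simultaneously along their paths, all of length [L]. *)
Lemma bridged_conn : conn bridged (side false) (side true).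
Proof.
have aux m : forall i X, i + m = L ->
    (forall x, x \in X -> fixl x r \/
      exists j t, [/\ j < p, t \in Om & x = pa (vtx false j i) t]) ->
    exists2 Y, walk bridged X (nseq m (r, false)) Y &
      (forall x, x \in Y -> fixl x r \/
      exists j t, [/\ j < p, t \in Om & x = pa (vtx false j L) t]).
  elim: m => [|m IH] i X im HX.
    by exists X => //; move: im; rewrite addn0 => <-.
  have iL : i < L by rewrite -im; lia.
  have st x : x \in X -> exists y, bridged x (r, false) y.
    case/HX => [fx|[j [t [jp tO ->]]]].
      by exists x; left; exact: (g_loop gE (l := (r, false))).
    exists (pa (vtx false j i.+1) t); have := bridged_step false t jp iL.
    by rewrite ((Omr t).1 tO).
  have [Y sY] := sstep_total st.
  have [||Z hZ HZ] := IH i.+1 Y; [by rewrite addSnnS | | by exists Z => //; exists Y].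
  move=> y; have [_ /[apply] [[x /HX hx xy]]] := sY.
  case: hx => [fx|[j [t [jp tO ex]]]].
    left; suff -> : y = x by [].
    apply: (g_fun bridged_pre xy); left.
    exact: (g_loop gE (l := (r, false))).
  right; exists j, t; split=> //; apply: (bridged_stepE jp iL).
  by rewrite ((Omr t).1 tO) -ex.
have [//||Y hY HY] := aux L 0 (side false).
  move=> x /sideP[fx|[j [t [jp tO ->]]]]; [by left|right].
  by exists j, t; rewrite vtx0.
suff eY : Y = side true by exists (nseq L (r, false)); rewrite -eY.
apply/eqP; rewrite eqEfcard; apply/andP; split.
  apply/fsubsetP => x /HY hx; apply/sideP.
  case: hx => [fx|[j [t [jp tO ->]]]]; [by left|right].
  by exists j, t; rewrite vtxL.
by rewrite -(walk_card bridged_pre hY) !side_kset.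
Qed.

End Closing.

(** * Free orbits and the consequence of robustness for invariant k-sets *)

Section Robust.
Local Open Scope nat_scope.

(** [NFr] of [Om] as a set of points, described by nontrivial stabilisers instead of orbits. *)
Definition nonfree (Om : {group T}) : {fset pt} :=
  [fset (inl i : pt) | i in [set i | [exists t in Om, (t != 1%g) && (ia i t == i)]]%SET].

Lemma nonfreeP (Om : {group T}) x : x \in nonfree Om <->
  exists t, [/\ t \in Om, t != 1%g & pa x t = x].
Proof.
split.
  case/imfsetP => i /=; rewrite finset.inE => /exists_inP[t tO /andP[t1 /eqP h]] ->.
  by exists t; rewrite /= h.
case=> t [tO t1 /[dup] h /(pa_fix t1)[i ei]]; apply/imfsetP; exists i => //=.
rewrite finset.inE; apply/exists_inP; exists t => //.
by rewrite t1; move: h; rewrite ei => -[->]; rewrite eqxx.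
Qed.

(** Regular orbits, each with [#|Om|] elements, are split off one by one. *)
Lemma free_orbits (X : {fset pt}) (Om : {group T}) :
  (forall x t, x \in X -> t \in Om -> pa x t \in X) ->
  (forall x t, x \in X -> t \in Om -> pa x t = x -> t = 1%g) ->
  exists p (e : nat -> pt), [/\
    forall x, x \in X <-> exists j t, [/\ j < p, t \in Om & x = pa (e j) t],
    forall j j' t, j < p -> j' < p -> t \in Om -> e j = pa (e j') t ->
      j = j' /\ t = 1%g
    & #|` X| = p * #|Om|].
Proof.
have [n] := ubnP #|` X|; elim: n X => // n IH X lt inv free.
have [->|[x xX]] := fset_0Vmem X.
  exists 0, (fun=> inr (0, 1%g)); split=> //.
  by move=> x; rewrite in_fset0; split=> // -[j [t []]].
pose O := [fset pa x t | t in Om].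
have xI t u : t \in Om -> u \in Om -> pa x t = pa x u -> t = u.
  move=> tO uO h; apply/eqP; rewrite eq_mulgV1; apply/eqP.
  by apply: (free x) => //; [rewrite groupM ?groupV | rewrite paM h paK].
have cO : #|` O| = #|Om|.
  by rewrite card_in_imfset ?cardE // => t u tO uO; exact: xI.
have OX : O `<=` X by apply/fsubsetP => _ /imfsetP[t /= tO ->]; exact: inv.
have Oinv y t : t \in Om -> (pa y t \in O) = (y \in O).
  have aux z u : u \in Om -> z \in O -> pa z u \in O.
    move=> uO /imfsetP[v /= vO ->]; rewrite -paM.
    by apply/imfsetP; exists (v * u)%g => //=; rewrite groupM.
  move=> tO; apply/idP/idP; last exact: aux.
  by move/(aux _ t^-1%g); rewrite groupV tO paK => /(_ isT).
have [|||p [e [eX eI cX]]] := IH (X `\` O).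
- by rewrite cardfsDS // cO; have := cardG_gt0 Om; have := fsubset_leq_card OX; rewrite cO; lia.
- by move=> y t; rewrite !in_fsetD => /andP[yO yX] tO; rewrite Oinv // yO inv.
- by move=> y t; rewrite in_fsetD => /andP[_]; exact: free.
exists p.+1, (fun j => if j is j'.+1 then e j' else x); split.
- move=> y; split.
    move=> yX; have [/imfsetP[t /= tO ->]|yO] := boolP (y \in O).
      by exists 0, t.
    have /eX[j [t [jp tO ->]]] : y \in X `\` O by rewrite in_fsetD yO.
    by exists j.+1, t.
  case=> -[|j] [t [jp tO ->]]; first exact: inv.
  have : pa (e j) t \in X `\` O by apply/eX; exists j, t.
  by rewrite in_fsetD => /andP[].
- have eO j : j < p -> e j \notin O.
    move=> jp; have : e j \in X `\` O.
      by apply/eX; exists j, 1%g; rewrite pa1 group1.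
    by rewrite in_fsetD => /andP[].
  have xO : x \in O by apply/imfsetP; exists 1%g; rewrite /= ?group1 ?pa1.
  move=> [|j] [|j'] t jp jp' tO.
  + by move=> h; split=> //; apply: (free x).
  + by move=> h; have := eO _ jp'; rewrite -(Oinv _ _ tO) -h xO.
  + by move=> h; have := eO _ jp; rewrite h Oinv // xO.
  + by case/eI => // ->.
- by rewrite mulSn -cX -cO cardfsDS // subnKC // fsubset_leq_card.
Qed.

Hypothesis rob : forall (Om : {group T}) (X : {set I}),
  X != finset.set0 -> (forall i t, i \in X -> t \in Om -> ia i t \in X) ->
  (forall i, i \in X -> exists t, [/\ t \in Om, t != 1%g & ia i t = i]) ->
  ~~ (#|Om| %| #|X|).

Lemma free_orbitsD (A : {fset pt}) (Om : {group T}) :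
  (forall t, t \in Om -> fa A t = A) ->
  exists p (e : nat -> pt), [/\
    forall x, x \in A `\` nonfree Om <->
      exists j t, [/\ j < p, t \in Om & x = pa (e j) t],
    forall j j' t, j < p -> j' < p -> t \in Om -> e j = pa (e j') t ->
      j = j' /\ t = 1%g
    & #|` A `\` nonfree Om| = p * #|Om|].
Proof.
move=> inv; apply: free_orbits => x t; rewrite !in_fsetD => /andP[xN xA] tO.
  rewrite -{1}(inv t tO) mem_fa xA andbT; apply: contra xN => /nonfreeP[u [uO u1 h]].
  apply/nonfreeP; exists (u ^ t^-1)%g; split.
  + by rewrite groupJ ?groupV.
  + by rewrite conjg_eq1.
  + by rewrite conjgE invgK !paM h paK.
move=> tx; apply: contraNeq xN => t1.
by apply/nonfreeP; exists t.
Qed.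

Lemma free_card (A : {fset pt}) (Om : {group T}) :
  (forall t, t \in Om -> fa A t = A) -> #|Om| %| #|` A `\` nonfree Om|.
Proof. by move/free_orbitsD => [p [e [_ _ ->]]]; exact: dvdn_mull. Qed.

Lemma nonfree_base Om : nonfree Om `<=` base.
Proof. by apply/fsubsetP => x /imfsetP[i _ ->]; exact: baseP. Qed.

(* |nonfree Om \ A| is divisible by |Om|, as the free parts of A and of the base
   consist of regular Om-orbits; so it is empty by robustness. *)
Lemma robust_sub (A : {fset pt}) (Om : {group T}) : kset A ->
  (forall t, t \in Om -> fa A t = A) -> nonfree Om `<=` A.
Proof.
move=> kA inv; pose X := [set i | (inl i : pt) \in nonfree Om `\` A]%SET.
have NX : nonfree Om `\` A = [fset (inl i : pt) | i in X].
  apply/fsetP => x; apply/idP/imfsetP => [|[i /= + ->]]; last by rewrite finset.inE.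
  move=> /[dup] h; rewrite in_fsetD => /andP[_ /imfsetP[i _ ei]].
  by exists i => //=; rewrite finset.inE -ei.
have cX : #|` nonfree Om `\` A| = #|X|.
  by rewrite NX card_imfset ?cardE //; exact: inl_inj.
have [X0|X0] := eqVneq X finset.set0.
  rewrite -fsetD_eq0 NX X0; apply/eqP/fsetP => x; rewrite in_fset0.
  by apply/negP => /imfsetP[i /=]; rewrite finset.inE.
have invX i t : i \in X -> t \in Om -> ia i t \in X.
  rewrite !finset.inE !in_fsetD => /andP[iA iN] tO; apply/andP; split.
    by apply: contra iA => h; rewrite -(mem_fa A t) inv.
  apply/nonfreeP; case/nonfreeP: iN => u [uO u1 h].
  exists (u ^ t)%g; split; [by rewrite groupJ | by rewrite conjg_eq1 |].
  by rewrite -[inl _]/(pa (inl i) t) -paM -conjgC paM h.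
have fixX i : i \in X -> exists t, [/\ t \in Om, t != 1%g & ia i t = i].
  rewrite finset.inE in_fsetD => /andP[_ /nonfreeP[t [tO t1 [h]]]].
  by exists t.
suff dv : #|Om| %| #|X| by have := rob X0 invX fixX; rewrite dv.
(* As [A] and the base have equal size, the size of [X] plus that of the free part of the base
   equals that of the free part of [A]; both free parts have size divisible by [#|Om|]. *)
have h1 := cardfsID (nonfree Om) A; have h2 := cardfsID (nonfree Om) base.
have h3 := cardfsID A (nonfree Om).
have e2 : base `&` nonfree Om = nonfree Om by apply/fsetIidPr; exact: nonfree_base.
rewrite e2 card_base -kA -h1 -h3 fsetIC cX -addnA in h2.
move/addnI: h2 => h2.
rewrite -(dvdn_addl _ (free_card (A := base) (fun t _ => fa_base t))) h2.
exact: free_card.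
Qed.

(** * Moving k-sets away from the old points and joining components *)

Lemma chain_below E E' M l n x y : bounded E M -> extends M l E E' ->
  chain E' l n x y -> chain E l n x y \/ ~~ below M y.
Proof.
(* New edges with letter [l] end at points not below [M], where no old edge starts, so a chain that
   has used one never returns. *)
move=> bE ex; have far m z u : chain E' l m z u -> ~~ below M z -> ~~ below M u.
  elim: m z => [|m IH] z /= => [->//|[v zv h] zM].
  apply: (IH v h); apply: (e_new ex zv _).2 => // /bE.
  by rewrite (negPf zM).
elim: n x => [|n IH] x /=; first by left.
case=> z xz h; have [xz'|/(e_new ex xz)[_ /(_ erefl) zM]] := pselect (E x l z).
  by case: (IH _ h) => [h'|]; [left; exists z | right].
by right; exact: (far _ _ _ h zM).
Qed.

Lemma chain_loop E l n x y : nice E -> fixl x l.1 -> chain E l n x y -> y = x.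
Proof.
move=> nE fx; elim: n => [|n IH] /=; first by move=> ->.
by case=> z xz; rewrite -(g_fun nE (g_loop nE fx) xz).
Qed.

Lemma chain_sstepV E A l n B : walk E A (nseq n l) B ->
  forall y, y \in B -> exists2 x, x \in A & chain E l n x y.
Proof.
elim: n A => [|n IH] A /=; first by move=> -> x xB; exists x.
case=> C [_ s2] /IH h y /h[z /s2[x xA xz] zy]; exists x => //.
by exists z.
Qed.

Lemma fixl_nonfree (Om : {group T}) s x :
  (forall t, t \in Om <-> sa s t = s) -> fixl x s <-> x \in nonfree Om.
Proof.
move=> Os; split=> [[t [t1 tx /Os tO]]|/nonfreeP[t [/Os ts t1 tx]]]; last by exists t.
by apply/nonfreeP; exists t.
Qed.

(** The number [p] of free orbits depends on [Om] alone, so two invariant k-sets can be matched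
    orbit by orbit. *)
Lemma kset_orbits (Om : {group T}) (A : {fset pt}) : kset A ->
  (forall t, t \in Om -> fa A t = A) -> nonfree Om `<=` A ->
  let p := (#|I| - #|` nonfree Om|) %/ #|Om| in
  exists e : nat -> pt, [/\
    forall x, x \in A <-> x \in nonfree Om \/
      exists j t, [/\ j < p, t \in Om & x = pa (e j) t],
    forall j t, j < p -> t \in Om -> pa (e j) t \in A `\` nonfree Om &
    forall j j' t, j < p -> j' < p -> t \in Om -> e j = pa (e j') t ->
      j = j' /\ t = 1%g].
Proof.
move=> kA inv NA p; have [q [e [eP eI cA]]] := free_orbitsD inv.
have -> : p = q by rewrite /p -kA -cardfsDS // cA mulnK.
exists e; split=> // [x|j t jq tO]; last by apply/eP; exists j, t.
split=> [xA|[/(fsubsetP NA)//|/eP]]; last by rewrite in_fsetD => /andP[].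
have [xN|xN] := boolP (x \in nonfree Om); [by left|right].
by apply/eP; rewrite in_fsetD xN.
Qed.

(* Moving A by a power of s larger than the lengths of the s-paths. *)
Lemma far_kset E M (A : {fset pt}) (Om : {group T}) s : good E -> bounded E M ->
  (forall t, t \in Om <-> sa s t = s) ->
  nonfree Om `<=` A -> (forall t, t \in Om -> fa A t = A) ->
  exists E' B, [/\ extends M (s, false) E E', conn E' A B,
    forall t, t \in Om -> fa B t = B, nonfree Om `<=` B &
    forall x, x \in B `\` nonfree Om -> ~~ below M x].
Proof.
move=> gE bE Os NA invA; have [K sK] := g_short gE.
have fixN x := fixl_nonfree x Os.
have [E' ex [B hB]] := extend_walk M A (s, false) K gE.
exists E', B; split=> //; first by eexists; exact: hB.
- move=> t tO; apply: (walk_fun (e_good ex) _ hB).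
  have := walk_act (e_good ex) t hB; rewrite invA // map_nseq.
  by rewrite /la /= ((Os t).1 tO).
- apply/fsubsetP => x /[dup] /fixN fx /(fsubsetP NA) xA.
  have [y yB] := chain_sstep hB xA.
  by move/(chain_loop (l := (s, false)) (e_good ex) fx) => <-.
move=> y; rewrite in_fsetD => /andP[yN yB].
have [x xA h] := chain_sstepV hB yB.
(* A chain of length [K] ending below [M] is old, hence starts at a forced fixed point and stays
   there. *)
case: (chain_below bE ex h) => // /sK /[dup] fx /fixN xN.
by case/negP: yN; rewrite (chain_loop (l := (s, false)) (e_good ex) fx h).
Qed.

(** Two letters in different [T]-orbits: [s] moves k-sets away, and [r], still undefined at the
    points reached, carries the bridge. *)
Hypothesis letters : forall Om : {group T},
  (exists i, forall t, t \in Om -> ia i t = i -> t = 1%g) ->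
  exists r s, [/\ forall t, t \in Om <-> sa r t = r,
    forall t, t \in Om <-> sa s t = s & forall t, sa s t <> r].

Lemma conn_sub (E E' : graph) A B : (forall x l y, E x l y -> E' x l y) ->
  conn E A B -> conn E' A B.
Proof. by move=> sub [w /(walk_mono sub)]; exists w. Qed.

Lemma fixed_rep E A : good E -> kset A ->
  exists (B : {fset pt}) (Om : {group T}), [/\ conn E A B,
    forall t, t \in Om -> fa B t = B &
    forall t, conn E B (fa B t) -> t \in Om].
Proof.
move=> gE kA; have [B cB fB] := fixed_kset gE (g_for gE) kA.
pose Om := [set t : T | fa B t == B]%SET.
have gOm : group_set Om.
  apply/group_setP; split=> [|t u]; rewrite !finset.inE ?fa1 //.
  by move=> /eqP h /eqP h'; rewrite faM h h'.
exists B, (group gOm); split=> // t; first by rewrite finset.inE => /eqP.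
move=> ct; rewrite finset.inE; apply/eqP/fB.
apply: (conn_trans cB); apply: (conn_trans ct).
by apply: (conn_act gE); exact: (conn_sym gE).
Qed.

(** A vertex [B] fixed by the stabiliser of its component is moved by [s] to a far k-set [B1], the
    base is moved by [s] to [A1], farther still, and a bridge labelled [r] joins [B1] to [A1]. *)
Lemma connect_step E A : good E -> kset A ->
  exists2 E', good E' & (forall x l y, E x l y -> E' x l y) /\ conn E' A base.
Proof.
move=> gE kA; have [cA|ncA] := pselect (conn E A base); first by exists E.
have [B [Om [cB invB stabB]]] := fixed_rep gE kA.
have kB : kset B by rewrite /kset -(conn_card gE cB).
have NB := robust_sub kB invB.
(* If [Om] had no free point in the base, [nonfree Om] would be the base, hence [B] the base and [A]
   connected to it. *)
have [|r [s [Or Os rs]]] := letters (Om := Om).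
  apply: contrapT => /forallNP none; apply: ncA; suff <- : B = base by [].
  apply/esym/eqP; rewrite eqEfcard kB card_base leqnn andbT.
  apply/fsubsetP => _ /imfsetP[i _ ->]; apply: (fsubsetP NB).
  apply/nonfreeP; have /existsNP[t /not_implyP[tO /not_implyP[it /eqP t1]]] := none i.
  by exists t; rewrite /= it.
have [M0 bE0] := g_bd gE; have [M1 bB] := exists_below B.
pose M := maxn M0 M1.
have bE : bounded E M by move=> x l y /bE0; apply: below_leq; rewrite /M; lia.
have {}bB t x : x \in fa B t -> below M x.
  by case/faP => y /bB h ->; rewrite below_pa; apply: below_leq h; rewrite /M; lia.
have [E1 [B1 [ex1 cB1 invB1 NB1 farB]]] := far_kset gE bE Os NB invB.
have [M2 bE2] := g_bd (e_good ex1); have [M3 bB1] := exists_below B1.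
pose M' := maxn M (maxn M2 M3).
have bE1 : bounded E1 M' by move=> x l y /bE2; apply: below_leq; rewrite /M'; lia.
have {}bB1 x : x \in B1 -> below M' x by move/bB1; apply: below_leq; rewrite /M'; lia.
(* The bound [M'] also covers [B1], so the free part of [A1] is disjoint from [B1]. *)
have [E2 [A1 [ex2 cA1 invA1 NA1 farA]]] :=
  far_kset (e_good ex1) bE1 Os (nonfree_base Om) (fun t _ => fa_base t).
have gE2 := e_good ex2; have [K sK] := g_short gE2.
have [M4 bE4] := g_bd gE2; have [M5 bA1] := exists_below A1.
pose N := maxn M' (maxn M4 M5).
have cBB1 : conn E2 B B1 by exact: conn_sub (e_sub ex2) cB1.
have kB1 : kset B1 by rewrite /kset -(conn_card gE2 cBB1).
have kA1 : kset A1 by rewrite /kset -(conn_card gE2 cA1) card_base.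
have [e0 [B1P e0in e0inj]] := kset_orbits kB1 invB1 NB1.
have [e1 [A1P e1in e1inj]] := kset_orbits kA1 invA1 NA1.
(* [e_conn] brings connections between [B], its translates and the base back from [E2] to [E], as
   all these sets are below the bounds. *)
have bB_B t : conn E2 B (fa B t) -> t \in Om.
  move=> h; apply: stabB; apply: (e_conn ex1); first 2 last.
  - apply: (e_conn ex2) h => x.
      by rewrite -{1}[B]fa1 => /bB; apply: below_leq; rewrite /M'; lia.
    by move/bB; apply: below_leq; rewrite /M'; lia.
  - by move=> x; rewrite -{1}[B]fa1 => /bB.
  - by move=> x /bB.
have nconn : ~ conn E2 B base.
  move=> h; apply: ncA; apply: (conn_trans cB); apply: (e_conn ex1); first 2 last.
  - apply: (e_conn ex2) h => x; last by case/imfsetP => i _ ->.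
    by rewrite -{1}[B]fa1 => /bB; apply: below_leq; rewrite /M'; lia.
  - by move=> x; rewrite -{1}[B]fa1 => /bB.
  - by move=> x /imfsetP[i _ ->].
pose p := (#|I| - #|` nonfree Om|) %/ #|Om|.
pose e (c : bool) := if c then e1 else e0.
pose side (c : bool) := if c then A1 else B1.
have far c j t : j < p -> t \in Om -> ~~ below M (pa (e c j) t).
  move=> jp tO; case: c => /=; last exact: farB (e0in _ _ jp tO).
  by apply: contra (farA _ (e1in _ _ jp tO)); apply: below_leq; rewrite /M'; lia.
(* Only letters in the orbit of [s] gained edges, so an edge with a letter in the orbit of [r] is
   one of [E] and starts below [M]. *)
have old t c x y : E2 x (sa r t, c) y -> below M x.
  have nr u : sa r t <> sa s u.
    move=> h; apply: (rs (u * t^-1)%g); rewrite saM -h -saM mulgV //.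
  move=> h; have [/bE //|h2] := pselect (E x (sa r t, c) y).
  have [h1|h1] := pselect (E1 x (sa r t, c) y).
    by have [[u /nr]] := e_new ex1 h1 h2.
  by have [[u /nr]] := e_new ex2 h h1.
have sideP c x : x \in side c <-> fixl x r \/
    exists j t, [/\ j < p, t \in Om & x = pa (e c j) t].
  by rewrite (fixl_nonfree x Or); case: c; [exact: A1P | exact: B1P].
have e_inj c j j' t : j < p -> j' < p -> t \in Om ->
    e c j = pa (e c j') t -> j = j' /\ t = 1%g.
  by case: c; [exact: e1inj | exact: e0inj].
have e_disj j j' t : j < p -> j' < p -> t \in Om ->
    e false j <> pa (e true j') t.
  move=> jp jp' tO /= h; have := farA _ (e1in _ _ jp' tO); rewrite -h bB1 //.
  by have := e0in _ _ jp (group1 Om); rewrite pa1 in_fsetD => /andP[].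
have e_free c j t c' y : j < p -> ~ E2 (e c j) (sa r t, c') y.
  move=> jp /old; apply/negP; have := far c j _ jp (group1 Om).
  by rewrite pa1.
have bE2' : bounded E2 N by move=> x l y /bE4; apply: below_leq; rewrite /N; lia.
have e_below c j : j < p -> below N (e c j).
  move=> jp; case: c => /=.
    have := e1in _ _ jp (group1 Om); rewrite pa1 in_fsetD => /andP[_ /bA1].
    by apply: below_leq; rewrite /N; lia.
  have := e0in _ _ jp (group1 Om); rewrite pa1 in_fsetD => /andP[_ /bB1].
  by apply: below_leq; rewrite /N; lia.
have side_kset c : kset (side c) by case: c.
have side_stab t : conn E2 (side false) (fa (side false) t) -> t \in Om.
  move=> h; apply: bB_B; apply: (conn_trans cBB1); apply: (conn_trans h).
  by apply: (conn_act gE2); exact: (conn_sym gE2).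
have side_conn t : ~ conn E2 (side false) (fa (side true) t).
  move=> h; apply: nconn; apply: (conn_trans cBB1); apply: (conn_trans h).
  by rewrite -(fa_base t); apply: (conn_act gE2); exact: (conn_sym gE2).
have gC := bridged_good gE2 sK bE2' Or sideP e_inj e_disj e_free e_below
  side_kset side_stab side_conn.
have cC := bridged_conn gE2 K bE2' Or sideP e_inj e_disj e_free e_below side_kset.
have sub12 x l y : E x l y -> E2 x l y by move/(e_sub ex1)/(e_sub ex2).
eexists; first exact: gC.
have sub x l y : E2 x l y -> bridged E2 K N p r e x l y by left.
split; first by move=> x l y /sub12/sub.
apply: (conn_trans (conn_sub sub (conn_sub sub12 cB))).
apply: (conn_trans (conn_sub sub cBB1)); apply: (conn_trans cC).
exact: (conn_sub sub (conn_sym gE2 cA1)).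
Qed.

(** * The limit graph, in which all letters are total and all k-sets are connected *)

Definition task : Type := (pt * letter + {fset pt})%type.
HB.instance Definition _ := Countable.on task.

Definition solved (E : graph) (z : task) : Prop :=
  match z with
  | inl u => exists y, E u.1 u.2 y
  | inr A => kset A -> conn E A base
  end.

Lemma solve E z : good E ->
  exists E', [/\ good E', forall x l y, E x l y -> E' x l y & solved E' z].
Proof.
move=> gE; case: z => [[x l]|A] /=.
  have [E' ex [y xy]] := extend_leaf 0 x l gE.
  exists E'; split; [exact: e_good ex | exact: e_sub ex | by exists y].
have [kA|nk] := pselect (kset A); last by exists E.
by have [E' gE' [sub c]] := connect_step gE kA; exists E'.
Qed.

Lemma seq_bound (X : eqType) (s : seq X) (P : nat -> X -> Prop) :
  (forall m n x, m <= n -> P m x -> P n x) ->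
  (forall x, x \in s -> exists n, P n x) -> exists n, forall x, x \in s -> P n x.
Proof.
move=> mono; elim: s => [|x s IH] H; first by exists 0.
have [n hn] := H x (mem_head _ _).
have [|m hm] := IH; first by move=> y ys; apply: H; rewrite mem_behead.
exists (maxn m n) => y; rewrite in_cons => /orP[/eqP->|/hm].
  by apply: mono hn; lia.
by apply: mono; lia.
Qed.

(** The countably many tasks are treated in the order of their codes, and a solved task stays
    solved. The union is a forest because a walk uses finitely many edges and so lies in one
    stage. *)
Lemma saturated : exists E, [/\ nice E, forall x l, exists y, E x l y &
  forall A, kset A -> conn E A base].
Proof.
pose gg := {E : graph | good E}.
have /choice[f fP] : forall nE : nat * gg, exists E' : gg,
    (forall x l y, sval nE.2 x l y -> sval E' x l y) /\
    forall z, choice.unpickle nE.1 = Some z -> solved (sval E') z.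
  move=> [n [E gE]] /=; case: (choice.unpickle n) => [z|]; last by exists (exist _ E gE).
  have [E' [gE' sub h]] := solve z gE; exists (exist _ E' gE').
  by split=> // z' [<-].
pose F := fix F n : gg := if n is m.+1 then f (m, F m) else exist _ E0 good_E0.
have gF n : good (sval (F n)) by exact: svalP.
have mono m n x l y : m <= n -> sval (F m) x l y -> sval (F n) x l y.
  move=> /subnK <-; elim: (n - m) => // d IH /IH; rewrite addSn.
  exact: (fP (d + m, F (d + m))%N).1.
pose E : graph := fun x l y => exists n, sval (F n) x l y.
have sub n x l y : sval (F n) x l y -> E x l y by exists n.
have solvedE z : solved E z.
  have [n] : exists n, solved (sval (F n)) z.
    exists (choice.pickle z).+1.
    exact: (fP (choice.pickle z, F (choice.pickle z))).2 z (choice.pickleK z).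
  case: z => [[x l] /= [y /sub xy]|A h kA]; first by exists y.
  exact: (conn_sub (@sub n) (h kA)).
have pE : pregraph E.
  split.
  - by move=> x l y t [n h]; exists n; exact: (g_eq (gF n)).
  - by move=> x l y [n h]; exists n; exact: (g_sym (gF n)).
  - move=> x l y y' [n h] [m h'].
    apply: (g_fun (gF (maxn m n)) (mono _ _ _ _ _ _ h) (mono _ _ _ _ _ _ h')); lia.
exists E; split.
- split=> //.
    by move=> x l h; exists 0; exact: (g_loop (gF 0)).
  have walkF A w B : walk E A w B -> exists n, walk (sval (F n)) A w B.
    elim: w A => [|l w IH] A /=; first by exists 0.
    case=> C [s1 s2] /IH[n h].
    have [||m h1] := @seq_bound _ A (fun n x => exists2 y, y \in C & sval (F n) x l y).
    + by move=> i j x ij [y yC xy]; exists y => //; exact: mono xy.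
    + by move=> x /s1[y yC [k xy]]; exists k, y.
    have [||k h2] := @seq_bound _ C (fun n y => exists2 x, x \in A & sval (F n) x l y).
    + by move=> i j x ij [y yC xy]; exists y => //; exact: mono xy.
    + by move=> x /s2[y yC [d xy]]; exists d, y.
    exists (maxn n (maxn m k)), C.
      by split=> x => [/h1|/h2] [y yC xy]; exists y => //; apply: mono xy; lia.
    by apply: walk_mono h => x l' y; apply: mono; lia.
  by move=> A w kA rw /walkF[n]; exact: (g_for (gF n)).
- by move=> x l; exact: (solvedE (inl (x, l))).
- by move=> A; exact: (solvedE (inr A)).
Qed.

(** * The group generated by the letters and [T] *)

Section Group.
Local Open Scope nat_scope.
Variables (E : graph) (nE : nice E) (tot : forall x l, exists y, E x l y)
  (conE : forall A, kset A -> conn E A base).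

Definition move (l : letter) (x : pt) : pt := sval (cid (tot x l)).

Lemma moveP l x : E x l (move l x).
Proof. exact: svalP (cid (tot x l)). Qed.

Lemma moveE l x y : E x l y -> move l x = y.
Proof. exact: (g_fun nE (moveP l x)). Qed.

Definition run (w : seq letter) (x : pt) := foldl (fun y l => move l y) x w.

Lemma run_cat v w x : run (v ++ w) x = run w (run v x).
Proof. exact: foldl_cat. Qed.

Lemma run_rcons v l x : run (rcons v l) x = move l (run v x).
Proof. by rewrite -cats1 run_cat. Qed.

Lemma move_act l x t : move (la l t) (pa x t) = pa (move l x) t.
Proof. by apply: moveE; apply: (g_eq nE); exact: moveP. Qed.

Lemma run_act w x t : run (map (la^~ t) w) (pa x t) = pa (run w x) t.
Proof. by elim: w x => //= l w IH x; rewrite /run /= move_act -/(run _ _) IH. Qed.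

Lemma moveK l : cancel (move l) (move (linv l)).
Proof. by move=> x; apply: moveE; apply: (g_sym nE); exact: moveP. Qed.

Lemma runK w : cancel (run w) (run (winv w)).
Proof.
elim: w => // l w IH x; rewrite winv_cons run_rcons.
by rewrite [run (l :: w) x]/(run w (move l x)) IH moveK.
Qed.

Lemma runVK w : cancel (run (winv w)) (run w).
Proof. by move=> x; rewrite -{1}(winvK w) runK. Qed.

Lemma run_reduce w : exists v, reducedw v /\ run v =1 run w.
Proof.
elim: w => [|l w [[|m v] [rv ev]]]; first by exists [::].
  by exists [:: l]; split=> // x; exact: (ev (move l x)).
have [h|ne] := boolP (nonback l m).
  exists [:: l, m & v]; split; first by rewrite /reducedw /= h.
  by move=> x; exact: (ev (move l x)).
move: ne rv ev; rewrite negbK => /eqP-> /path_sorted rv ev.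
by exists v; split=> // x; have := ev (move l x); rewrite /run /= moveK.
Qed.

Lemma walk_run A w : walk E A w [fset run w x | x in A].
Proof.
elim: w A => [|l w IH] A /=.
  apply/fsetP => x; apply/idP/imfsetP => [xA|[y /= yA ->] //].
  by exists x.
exists [fset move l x | x in A].
  split=> [x xA|y /imfsetP[x /= xA ->]]; last by exists x => //; exact: moveP.
  by exists (move l x); [exact: in_imfset | exact: moveP].
suff <- : [fset run w x | x in [fset move l x | x in A]] =
          [fset run (l :: w) x | x in A] by [].
by rewrite -imfset_comp.
Qed.

Lemma run_free A w : kset A -> reducedw w -> [fset run w x | x in A] = A -> w = [::].
Proof. by move=> kA rw h; apply: (g_for nE kA rw); rewrite -{2}h; exact: walk_run. Qed.

(** Normal form in the semidirect product: a word followed by an element of [T]. *)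
Definition Gfun (f : pt -> pt) := exists w t, forall x, f x = pa (run w x) t.

Lemma Gfun1 : Gfun id.
Proof. by exists [::], 1%g => x; rewrite pa1. Qed.

Lemma GfunM f g : Gfun f -> Gfun g -> Gfun (g \o f).
Proof.
(* Passing [t] across the second word twists its letters by [t^-1]. *)
move=> [w [t ef]] [v [u eg]]; exists (w ++ map (la^~ t^-1%g) v), (t * u)%g => x /=.
rewrite eg ef run_cat paM -(run_act _ (run w x) t) -map_comp.
by rewrite (eq_map (g := id)) ?map_id // => l /=; rewrite -laM mulVg la1.
Qed.

Lemma GfunV f : Gfun f -> exists g, [/\ Gfun g, cancel f g & cancel g f].
Proof.
move=> [w [t ef]]; exists (fun y => run (winv w) (pa y t^-1%g)); split.
- exists (map (la^~ t) (winv w)), t^-1%g => y.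
  by rewrite -{2}(paKV t y) run_act paK.
- by move=> x; rewrite ef paK runK.
- by move=> y; rewrite ef runVK paKV.
Qed.

Definition G : groupType := fgroup Gfun1 GfunM GfunV.
Definition Gact : right_action G pt := fgroup_action Gfun1 GfunM GfunV.

Lemma G_ext (f g : G) : sval f =1 sval g -> f = g.
Proof. exact: fgroup_ext. Qed.

Lemma gword_subproof w : Gfun (run w).
Proof. by exists w, 1%g => x; rewrite pa1. Qed.
Definition gword w : G := exist _ _ (gword_subproof w).

Lemma gelt_subproof t : Gfun (pa^~ t).
Proof. by exists [::], t. Qed.
Definition gelt t : G := exist _ _ (gelt_subproof t).

Lemma gword_cat v w : gword (v ++ w) = (gword v * gword w)%g.
Proof. by apply: G_ext => x; exact: run_cat. Qed.

Lemma gword_inv w : gword (winv w) = ((gword w)^-1)%g.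
Proof.
apply: (@mulIg _ (gword w)); rewrite mulVg; apply: G_ext => x.
exact: runVK.
Qed.

Lemma geltM t u : gelt (t * u)%g = (gelt t * gelt u)%g.
Proof. by apply: G_ext => x; exact: paM. Qed.

Lemma gelt1 : gelt 1%g = 1%g.
Proof. by apply: G_ext => x; exact: pa1. Qed.

Lemma G_decomp (g : G) : exists w t, reducedw w /\ g = (gword w * gelt t)%g.
Proof.
have [w [t h]] := svalP g; have [v [rv ev]] := run_reduce w.
by exists v, t; split=> //; apply: G_ext => x; rewrite h -ev.
Qed.

Lemma G_trans A : kset A -> exists g : G, [fset sval g x | x in A] = base.
Proof.
move=> kA; have [w h] := conE kA; exists (gword w).
exact: (walk_fun nE (walk_run A w) h).
Qed.

(** [T] preserves the base, so the word part of [g] does too, and it is empty by the forest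
    property. *)
Lemma G_stab (g : G) : [fset sval g x | x in base] = base -> exists t, g = gelt t.
Proof.
have [w [t [rw ->]]] := G_decomp g => h; exists t.
have -> : w = [::]; last by apply: G_ext.
apply: (run_free card_base rw); rewrite -[RHS](fa_base t^-1%g) -[in RHS]h.
apply/fsetP => x; rewrite in_fa invgK; apply/imfsetP/imfsetP => -[y /= yb].
  by move=> ->; exists y.
by move/(can_inj (paK t)) => ->; exists y.
Qed.

Local Open Scope classical_set_scope.

Definition gens : set G := range (fun s => gword [:: (s, false)]).

Lemma gword_neg s : gword [:: (s, true)] = ((gword [:: (s, false)])^-1)%g.
Proof. exact: (gword_inv [:: (s, false)]). Qed.

Lemma subgroup_gword (H : set G) : subgroup H -> gens `<=` H -> forall w, H (gword w).
Proof.
move=> /subgroupP[h1 hd] sub.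
have hV g : H g -> H (g^-1)%g by move=> hg; rewrite -[(_^-1)%g]mul1g; exact: hd.
have hM f g : H f -> H g -> H (f * g)%g.
  by move=> hf hg; rewrite -[g]invgK; apply: hd => //; exact: hV.
elim=> [|[s b] w IH]; first by rewrite (_ : gword [::] = 1%g) //; exact: G_ext.
rewrite -cat1s gword_cat; apply: hM => //.
by case: b; [rewrite gword_neg; apply: hV|]; apply: sub; exists s.
Qed.

Lemma G_fin_gen : finitely_generated G.
Proof.
exists (gens `|` range gelt).
  rewrite finite_setU; split; apply: finite_image; exact: finite_finset.
apply/seteqP; split=> // g _ H [/= sH sub].
have [w [t [_ ->]]] := G_decomp g.
have hw : H (gword w) by apply: subgroup_gword => // h hh; apply: sub; left.
have hV : H (gelt t^-1%g) by apply: sub; right; exists (t^-1)%g.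
have [_ hd] := (subgroupP H).1 sH.
have -> : gelt t = ((gelt t^-1%g)^-1)%g.
  by apply: (@mulIg _ (gelt t^-1%g)); rewrite mulVg -geltM mulgV gelt1.
exact: hd.
Qed.

(** Equal elements move the base to the same k-set, and reduced walks with given ends are unique. *)
Lemma gword_inj v w : reducedw v -> reducedw w -> gword v = gword w -> v = w.
Proof.
move=> rv rw h; apply: (walk_unique nE (g_for nE) card_base rv rw (walk_run base v)).
suff -> : [fset run v x | x in base] = [fset run w x | x in base] by exact: walk_run.
by have /= -> : run v = run w := congr1 sval h.
Qed.

Definition wordset : set G := range gword.

Definition gletter (l : letter) : G * bool := (gword [:: (l.1, false)], l.2).

Lemma word_val_gletter w : word_val (map gletter w) = gword w.
Proof.
rewrite /word_val; elim: w => [|[s b] w IH].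
  by rewrite big_nil; apply: G_ext.
rewrite /= big_cons IH /= -[(s, b) :: w]cat1s gword_cat; case: b => //.
by rewrite gword_neg.
Qed.

Lemma gletter_inj : injective gletter.
Proof.
move=> [s b] [s' b'] h; have -> : b = b' := congr1 snd h.
have /gword_inj := congr1 fst h : gword [:: (s, false)] = gword [:: (s', false)].
by case/(_ isT isT) => ->.
Qed.

Lemma reduced_gletter w : reduced (map gletter w) = reducedw w.
Proof.
rewrite /reduced /reducedw sorted_map; apply: eq_sorted => -[s b] [s' b'].
rewrite /relpre /= /nonback /linv /= xpair_eqE negb_and.
have -> : (gword [:: (s, false)] == gword [:: (s', false)]) = (s == s').
  by apply/eqP/eqP => [h|-> //]; have [] := @gletter_inj (s, b) (s', b) (congr1 (pair^~ b) h).
by rewrite negb_and eq_sym; case: b b' => -[].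
Qed.

Lemma reduced_wordsP w : reduced_words gens w ->
  exists v, reducedw v /\ w = map gletter v.
Proof.
move=> [rw hw]; suff [v e] : exists v, w = map gletter v.
  by exists v; rewrite -reduced_gletter -e.
elim: w hw {rw} => [|[g b] w IH] hw; first by exists [::].
have [|v ->] := IH; first by move=> l lw; apply: hw; rewrite in_cons lw orbT.
have [s _ /= <-] := hw _ (mem_head _ _).
by exists ((s, b) :: v).
Qed.

(** Distinct reduced words give distinct elements, so the words form a free group on [gens]; the
    elements of [T] represent its cosets. *)
Lemma G_virt_free : virtually_free G.
Proof.
exists wordset.
  split.
    apply/subgroupP; split; first by exists [::] => //; apply: G_ext.
    move=> _ _ [v _ <-] [w _ <-]; exists (v ++ winv w) => //.
    by rewrite gword_cat gword_inv.
  exists gens; split.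
  - move=> w /reduced_wordsP[v [_ ->]].
    by rewrite word_val_gletter; exists v.
  - move=> w w' /set_mem/reduced_wordsP[v [rv ->]] /set_mem/reduced_wordsP[v' [rv' ->]].
    by rewrite !word_val_gletter => /(gword_inj rv rv') ->.
  - move=> _ [w _ <-]; have [v [rv ev]] := run_reduce w.
    exists (map gletter v); last by rewrite word_val_gletter; apply: G_ext.
    split; first by rewrite reduced_gletter.
    by move=> _ /mapP[l _ ->]; exists l.1.
apply: (sub_finite_set (B := range (fun t => [set h * gelt t | h in wordset])%g)).
  move=> _ [g _ <-]; have [w [t [_ ->]]] := G_decomp g.
  exists t => //; apply/seteqP; split=> _ [_ [v _ <-] <-].
    exists (gword v * (gword w)^-1)%g; last by rewrite mulgA mulgKV.
    by exists (v ++ winv w) => //; rewrite gword_cat gword_inv.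
  exists (gword (v ++ w)); first by exists (v ++ w).
  by rewrite mulgA gword_cat.
by apply: finite_image; exact: finite_finset.
Qed.

Lemma G_nonabelian (s r : S) : s != r -> ~ abelian_group G.
Proof.
move=> sr ab; have h : commute (gword [:: (s, false)]) (gword [:: (r, false)]) := ab _ _.
have red u v : reducedw [:: (u, false); (v, false)].
  by rewrite /reducedw /= andbT /nonback xpair_eqE andbF.
have : gword ([:: (s, false)] ++ [:: (r, false)]) =
       gword ([:: (r, false)] ++ [:: (s, false)]) by rewrite !gword_cat.
case/(gword_inj (red _ _) (red _ _)) => e.
by rewrite e eqxx in sr.
Qed.

End Group.

Lemma exists_action : exists (G : groupType) (to : right_action G pt) (emb : T -> G),
  [/\ forall A, kset A -> exists g, [fset to x g | x in A] = base,
      forall g, [fset to x g | x in base] = base -> exists t, g = emb t,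
      forall x t, to x (emb t) = pa x t,
      forall g h, to^~ g =1 to^~ h -> g = h
    & [/\ finitely_generated G, virtually_free G &
        forall s r : S, s != r -> ~ abelian_group G]].
Proof.
have [E [nE tot conE]] := saturated.
exists (G nE tot), (Gact nE tot), (gelt nE tot); split.
- by move=> A kA; exact: (G_trans nE tot conE kA).
- exact: G_stab.
- by [].
- exact: G_ext.
- split; [exact: G_fin_gen | exact: G_virt_free | exact: G_nonabelian].
Qed.

End Robust.
End Graph.

(** * Images of sets under a group action *)

Section Images.
Local Open Scope classical_set_scope.
Variables (G : groupType) (U : Type) (to : right_action G U).

Lemma ractK g : cancel (to^~ g) (to^~ (g^-1)%g).
Proof. by move=> x; rewrite -ractM mulgV ract1. Qed.

Lemma ractKV g : cancel (to^~ (g^-1)%g) (to^~ g).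
Proof. by move=> x; rewrite -ractM mulVg ract1. Qed.

Lemma image_ractM (A : set U) g h : to^~ (g * h)%g @` A = to^~ h @` (to^~ g @` A).
Proof. by rewrite image_comp; congr image; apply/funext => x /=; rewrite ractM. Qed.

Lemma image_ract1 (A : set U) : to^~ 1%g @` A = A.
Proof.
by rewrite (_ : to^~ 1%g = id) ?image_id //; apply/funext => x; exact: ract1.
Qed.

Lemma image_ractK (A B : set U) g : to^~ g @` A = B -> to^~ (g^-1)%g @` B = A.
Proof. by move=> <-; rewrite -image_ractM mulgV image_ract1. Qed.

End Images.

(** * The letters for a robust group, and its sharply transitive action *)

Section Sufficiency.
Variables (k : nat) (Theta : {group 'S_k}) (k0 : 0 < k) (rob : robust Theta).

Let T : finGroupType := subg_of Theta.

Definition tact (i : 'I_k) (t : T) : 'I_k := aperm i (sgval t).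

Lemma tact1 i : tact i 1%g = i.
Proof. by rewrite /tact morph1 apermE perm1. Qed.

Lemma tactM i t u : tact i (t * u)%g = tact (tact i t) u.
Proof. by rewrite /tact morphM ?inE // /aperm permM. Qed.

(* Letters are subsets of T with T acting by right translation (in two copies), so
   that every subgroup is the stabiliser of a letter. *)
Definition symb_ok (z : {set T} * bool) :=
  [exists i : 'I_k, [forall t : T, (tact i t == i) && (z.1 :* t == z.1)%g ==> (t == 1%g)]].

Definition symb : Type := {z : {set T} * bool | symb_ok z}.
HB.instance Definition _ := Finite.on symb.

Lemma symb_okP z : reflect (exists i, forall t,
  tact i t = i -> (z.1 :* t)%g = z.1 -> t = 1%g) (symb_ok z).
Proof.
apply: (iffP existsP) => -[i h]; exists i.
  by move=> t ti zt; move/forallP/(_ t): h; rewrite ti zt !eqxx => /eqP.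
by apply/forallP => t; apply/implyP => /andP[/eqP ti /eqP zt]; apply/eqP/h.
Qed.

Lemma symb_ok_act z t : symb_ok z -> symb_ok ((z.1 :* t)%g, z.2).
Proof.
move=> /symb_okP[i h]; apply/symb_okP; exists (tact i t) => u /= iu zu.
apply: (conjg_inj t^-1%g); rewrite conj1g; apply: h.
  by rewrite conjgE invgK !tactM iu -tactM mulgV tact1.
by rewrite conjgE invgK !rcosetM zu -rcosetM mulgV rcoset1.
Qed.

Definition symb_act (s : symb) (t : T) : symb :=
  exist _ (((sval s).1 :* t)%g, (sval s).2) (symb_ok_act t (svalP s)).

Lemma symb_act1 s : symb_act s 1%g = s.
Proof. by apply: val_inj; rewrite /= rcoset1; case: (sval s). Qed.

Lemma symb_actM s t u : symb_act s (t * u)%g = symb_act (symb_act s t) u.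
Proof. by apply: val_inj; rewrite /= rcosetM. Qed.

Lemma symb_free s : exists i, forall t, tact i t = i -> symb_act s t = s -> t = 1%g.
Proof.
case: s => z zok; have /symb_okP[i h] := zok; exists i => t ti /(congr1 val) /= e.
by apply: h => //; rewrite -[in RHS]e.
Qed.

Lemma symb_exists (Om : {group T}) :
  (exists i, forall t, t \in Om -> tact i t = i -> t = 1%g) ->
  exists r s, [/\ forall t, t \in Om <-> symb_act r t = r,
    forall t, t \in Om <-> symb_act s t = s & forall t, symb_act s t <> r].
Proof.
move=> [i h]; have st (t : T) : t \in Om <-> (Om :* t)%g = Om.
  split; first exact: rcoset_id.
  by move=> e; rewrite -e rcoset_refl.
have ok b : symb_ok (Om : {set T}, b).
  by apply/symb_okP; exists i => t ti /= /st tO; exact: h.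
exists (exist (fun z => symb_ok z) _ (ok true)), (exist (fun z => symb_ok z) _ (ok false)).
split.
- move=> t; rewrite st; split=> [e|/(congr1 val) [] //].
  by apply: val_inj; rewrite /= e.
- move=> t; rewrite st; split=> [e|/(congr1 val) [] //].
  by apply: val_inj; rewrite /= e.
- by move=> t /(congr1 val) [].
Qed.

Lemma NFr_intro (Om : {group 'S_k}) i s : s \in Om -> s != 1%g -> aperm i s = i ->
  i \in NFr Om.
Proof.
move=> sO s1 si; apply/bigcupP; exists (orbit 'P Om i); last exact: orbit_refl.
rewrite imset_f //=; apply/forall_inPn; exists i; first exact: orbit_refl.
apply/trivgPn; exists s => //; apply/setIP; split=> //.
by apply/astab1P.
Qed.

Lemma robust_subg (Om : {group T}) (X : {set 'I_k}) :
  X != finset.set0 -> (forall i t, i \in X -> t \in Om -> tact i t \in X) ->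
  (forall i, i \in X -> exists t, [/\ t \in Om, t != 1%g & tact i t = i]) ->
  ~~ (#|Om| %| #|X|).
Proof.
move=> X0 inv fix_.
have <- : #|(sgval @* Om)%g| = #|Om| by rewrite card_injm ?injm_sgval ?finset.subsetT.
apply: (rob (Omega := (sgval @* Om)%G)) => //.
- by apply/fintype.subsetP => _ /morphimP[t _ _ ->]; exact: subgP.
- apply/fintype.subsetP => _ /morphimP[t _ tO ->]; apply/astabsP => i.
  apply/idP/idP => [h|]; last by move=> iX; apply: inv.
  have : tact (tact i t) t^-1%g \in X := inv _ _ h (groupVr tO).
  by rewrite -tactM mulgV tact1.
apply/fintype.subsetP => i /fix_[t [tO t1 ti]].
apply: (NFr_intro (s := sgval t)); first by apply: mem_morphim; rewrite ?inE.
  by apply: contra t1 => /eqP e; apply/eqP; apply: val_inj; rewrite /= e.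
exact: ti.
Qed.

Lemma infinite_pt : infinite_set [set: pt T 'I_k]%classic.
Proof.
move=> /finite_fsetP[X eX]; have [M bM] := exists_below X.
have : (inr (M, 1%g) : pt T 'I_k) \in X by move/seteqP: eX => [h _]; exact: h.
by move/bM; rewrite /= ltnn.
Qed.

Lemma image_fset (V : choiceType) (f : V -> V) (A : {fset V}) :
  (f @` [set` A] = [set` [fset f x | x in A]%fset])%classic.
Proof.
apply/seteqP; split=> [_ [x xA <-]|_ /imfsetP[x /= xA ->]].
  by apply/imfsetP; exists x.
by exists x.
Qed.

Local Open Scope classical_set_scope.
Local Open Scope card_scope.

Lemma card_kset (A : set (pt T 'I_k)) : A #= `I_k ->
  exists B : {fset pt T 'I_k}, kset B /\ A = [set` B].
Proof.
move=> cA; have /finite_fsetP[B eB] : finite_set A by exists k.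
by exists B; split=> //; rewrite /kset card_ord; apply/card_eq_fsetP; rewrite -eB.
Qed.

Lemma action_exists : exists (G : groupType) (U : Type) (to : right_action G U),
  [/\ infinite_set [set: U], sharply_transitive to Theta, finitely_generated G,
      ~ abelian_group G & virtually_free G].
Proof.
have [G [to [emb [trans stab embE faith [fg vf nab]]]]] :=
  exists_action tact1 tactM symb_act1 symb_actM symb_free robust_subg symb_exists.
exists G, (pt T 'I_k), to.
set base_ := [set` base T 'I_k].
have cbase : base_ #= `I_k.
  by apply/card_eq_fsetP; rewrite [LHS]card_base card_ord.
have transS A : A #= `I_k -> exists g, to^~ g @` A = base_.
  move=> /card_kset[B [kB ->]]; have [g eg] := trans B kB.
  by exists g; rewrite image_fset eg.
have stabS g : to^~ g @` base_ = base_ -> exists t, g = emb t.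
  rewrite image_fset => h; apply: stab; apply/fsetP => x.
  by move/seteqP: h => [h1 h2]; apply/idP/idP => [/h1|/h2].
have embS t : to^~ (emb t) @` base_ = base_.
  rewrite image_fset (_ : [fset to x (emb t) | x in _]%fset = base T 'I_k) //.
  rewrite -[RHS](fa_base tact1 tactM t).
  by apply/fsetP => x; apply/imfsetP/imfsetP => -[y /= yb ->]; exists y.
have embI : injective emb.
  move=> t u h; have := embE (inr (0, 1%g)) t; rewrite h embE /= !mul1g.
  by case.
have embM t u : emb (t * u)%g = (emb t * emb u)%g.
  by apply: faith => x; rewrite ractM !embE paM //; exact: tactM.
split=> //; first exact: infinite_pt; last first.
  (* The trivial subgroup has a free point, since [k] is positive, and so provides two distinct
     letters. *)
  have [|r [s [_ _ rs]]] := @symb_exists 1%G.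
    by exists (Ordinal k0) => t /set1P.
  apply: (nab s r); apply/eqP => e; apply: (rs 1%g).
  by rewrite symb_act1.
split.
- by rewrite -(card_le_eql cbase); exact: subset_card_le.
- move=> A B /transS[g gA] /transS[h hB]; exists (g * h^-1)%g.
  by rewrite image_ractM gA -hB (image_ractK (erefl _)).
move=> A /transS[g gA].
(* Conjugation by [g] turns the stabiliser of [A] into that of the base, which is the image of
   [T]. *)
have conj h : set_stab to A h -> exists t, (g^-1 * h * g)%g = emb t.
  move=> hA; apply: stabS.
  by rewrite !image_ractM (image_ractK gA) [X in _ @` X]hA.
have /choice[f fP] : forall h : G, exists s : 'S_k,
    forall t, (g^-1 * h * g)%g = emb t -> s = sgval t.
  move=> h; have [[t ht]|no] := pselect (exists t, (g^-1 * h * g)%g = emb t).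
    by exists (sgval t) => u; rewrite ht => /embI ->.
  by exists 1%g => t ht; case: no; exists t.
have inA x : A x -> exists i, to x g = inl i.
  move=> Ax; have : base_ (to x g) by rewrite -gA; exists x.
  by case/imfsetP => i _ ->; exists i.
(* The default value is never taken on [A], by [inA]. *)
pose alpha x := if to x g is inl i then i else Ordinal k0.
exists alpha, f; split.
- split=> //.
  + move=> x y /set_mem/inA[i xi] /set_mem/inA[j yj]; rewrite /alpha xi yj => ij.
    by apply: (can_inj (ractK to g)); rewrite xi yj ij.
  + move=> i _; have : base_ (inl i) by exact: baseP.
    by rewrite -gA => -[x Ax xi]; exists x => //; rewrite /alpha xi.
- split.
  + by move=> h /conj[t ht] /=; rewrite (fP _ _ ht) subgP.
  + move=> h h' /set_mem/conj[t ht] /set_mem/conj[t' ht'].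
    rewrite (fP _ _ ht) (fP _ _ ht') => /val_inj tt'.
    have : (g^-1 * h * g = g^-1 * h' * g)%g by rewrite ht ht' tt'.
    by move/mulIg/mulgI.
  + move=> s sT; pose t : T := subg Theta s.
    have ht : (g^-1 * (g * emb t * g^-1) * g)%g = emb t.
      by rewrite !mulgA mulVg mul1g mulgKV.
    exists (g * emb t * g^-1)%g; last by rewrite (fP _ _ ht) /t subgK.
    by rewrite /set_stab /= !image_ractM gA embS (image_ractK gA).
- move=> h h' /conj[t ht] /conj[t' ht'].
  have htt' : (g^-1 * (h * h') * g)%g = emb (t * t')%g.
    by rewrite embM -ht -ht' !mulgA mulgK.
  by rewrite (fP _ _ ht) (fP _ _ ht') (fP _ _ htt').
move=> x h /inA[i xi] /conj[t ht]; rewrite (fP _ _ ht) /alpha xi.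
have -> : to (to x h) g = to (to x g) (emb t).
  by rewrite -ht -!ractM !mulgA mulgV mul1g.
by rewrite xi embE.
Qed.

End Sufficiency.

(** * Necessity of robustness *)

Lemma NFrP k (Om : {group 'S_k}) i :
  i \in NFr Om -> exists s, [/\ s \in Om, s != 1%g & aperm i s = i].
Proof.
case/bigcupP => O /andP[/imsetP[j _ ->]] /forall_inPn[x xj /trivgPn[t]] tC t1 ij.
have /orbitP[u uO ui] : i \in orbit 'P Om x.
  by rewrite (orbit_in_eqP _ xj) ?finset.subsetT.
case/setIP: tC => tO /astab1P tx.
exists (t ^ u)%g; split; [by rewrite groupJ | by rewrite conjg_eq1 |].
rewrite -ui -[aperm _ _]/('P%act ('P%act x u) (t ^ u)%g) -actM -conjgC actM.
by rewrite tx.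
Qed.

Section Necessity.
Local Open Scope classical_set_scope.
Local Open Scope card_scope.
Variables (k : nat) (Theta : {group 'S_k}) (G : groupType) (U : choiceType).
Variables (to : right_action G U) (infU : infinite_set [set: U]).
Hypothesis sharp : sharply_transitive to Theta.

Lemma fset_subset_card (B : {fset U}) n : n <= #|` B| ->
  exists A : {fset U}, (A `<=` B)%fset /\ #|` A| = n.
Proof.
move=> nB; exists [fset x in take n B]%fset; split.
  by apply/fsubsetP => x; rewrite in_fset /= => /mem_take.
by rewrite card_fseq undup_id ?size_take_min ?take_uniq ?fset_uniq //; apply/minn_idPl.
Qed.

(** The isomorphism for one k-subset, read backwards: [a] numbers the subset and [phi] inverts the
    group part on [Theta]. *)
Lemma frame : exists (a : 'I_k -> U) (phi : 'S_k -> G),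
  [/\ injective a, range a #= `I_k,
     forall s t, s \in Theta -> t \in Theta -> phi (s * t)%g = (phi s * phi t)%g,
     forall i s, s \in Theta -> to (a i) (phi s) = a (aperm i s) &
     forall g, to^~ g @` range a = range a -> exists2 s, s \in Theta & g = phi s].
Proof.
have [_ _ iso] := sharp.
have [B _ kB] := infinite_set_fset k infU.
have [A [_ /card_eq_fsetP cA]] := fset_subset_card kB.
have [alpha [f [[aA ainj asurj] [fT finj fsurj] fM eqv]]] := iso _ cA.
have /choice[a aP] : forall i, exists x, [set` A] x /\ alpha x = i.
  by move=> i; have [x xA xi] := asurj i I; exists x.
have /choice[phi phiP] : forall s, exists g, s \in Theta ->
    set_stab to [set` A] g /\ f g = s.
  move=> s; have [sT|_] := boolP (s \in Theta); last by exists 1%g.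
  by have [g gA gs] := fsurj s sT; exists g.
have aalpha x : [set` A] x -> a (alpha x) = x.
  move=> xA; have [h1 h2] := aP (alpha x).
  by apply: ainj h2; apply: mem_set.
have eA : range a = [set` A].
  apply/seteqP; split=> [_ [i _ <-]|x xA]; first by case: (aP i).
  by exists (alpha x) => //; exact: aalpha.
have stabM g h : set_stab to [set` A] g -> set_stab to [set` A] h ->
    set_stab to [set` A] (g * h)%g.
  by rewrite /set_stab /= image_ractM => -> ->.
have fI g h : set_stab to [set` A] g -> set_stab to [set` A] h -> f g = f h -> g = h.
  by move=> gA hA; apply: finj; apply: mem_set.
exists a, phi; rewrite eA; split=> //.
- by move=> i j h; rewrite -(aP i).2 -(aP j).2 h.
- move=> s t sT tT; have [h1 e1] := phiP _ sT; have [h2 e2] := phiP _ tT.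
  have [h3 e3] := phiP _ (groupM sT tT); apply: fI => //; first exact: stabM.
  by rewrite fM // e1 e2 e3.
- move=> i s sT; have [h1 e1] := phiP _ sT; have [h2 e2] := aP i.
  have := eqv _ _ h2 h1; rewrite e1 e2 => <-; rewrite aalpha //.
  have h3 : to^~ (phi s) @` [set` A] = [set` A] := h1.
  by rewrite -[X in X _]h3; exists (a i).
move=> g gA; have sT := fT _ gA; exists (f g) => //.
by have [h1 e1] := phiP _ sT; apply: fI.
Qed.

Lemma finite_cover (J : eqType) (s : seq J) (P : J -> U -> Prop) :
  (forall i, i \in s -> exists Z : {fset U}, forall x, P i x -> x \in Z) ->
  exists Z : {fset U}, forall i x, i \in s -> P i x -> x \in Z.
Proof.
elim: s => [|j s IH] H; first by exists fset0.
have [Z hZ] := H j (mem_head _ _).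
have [|W hW] := IH; first by move=> i si; apply: H; rewrite in_cons si orbT.
exists (Z `|` W)%fset => i x; rewrite in_cons in_fsetU => /orP[/eqP->|si].
  by move/hZ ->.
by move/(hW _ _ si) ->; rewrite orbT.
Qed.

(** A point outside [W] has a regular orbit, and one that also avoids the translates of the points
    already in use has a new orbit; such points exist since [U] is infinite. *)
Lemma fresh_orbits (phi : 'S_k -> G) (Om : {group 'S_k}) (W : {fset U}) :
  (forall s t, s \in Om -> t \in Om -> phi (s * t)%g = (phi s * phi t)%g) ->
  (forall x s, s \in Om -> s != 1%g -> to x (phi s) = x -> x \in W) ->
  forall p (Z : {fset U}), exists F : {fset U}, [/\ forall x, x \in F -> x \notin Z,
    forall x s, x \in F -> s \in Om -> to x (phi s) \in F &
    #|` F| = (p * #|Om|)%N].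
Proof.
move=> phiM fixW; have phi1 : phi 1%g = 1%g.
  by apply: (@mulgI _ (phi 1%g)); rewrite -phiM ?group1 // !mulg1.
elim=> [|p IH] Z.
  by exists fset0; split=> //; rewrite cardfs0.
have [F [FZ Finv cF]] := IH Z.
pose V := (W `|` [fset to z (phi s) | z in (Z `|` F)%fset, s in Om])%fset.
have [x xV] : exists x, x \notin V.
  apply: contrapT => /forallNP h; apply: infU; apply/finite_fsetP; exists V.
  by apply/seteqP; split=> // x _ /=; apply/negPn/negP/h.
have [xW xO] : x \notin W /\ forall z s, z \in (Z `|` F)%fset -> s \in Om ->
    x != to z (phi s).
  move: xV; rewrite in_fsetU negb_or => /andP[-> xO]; split=> // z s zV sO.
  by apply: contra xO => /eqP->; apply/imfset2P; exists z => //; exists s.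
pose O := [fset to x (phi s) | s in Om]%fset.
have cO : #|` O| = #|Om|.
  rewrite card_in_imfset ?cardE // => s t /= sO tO e; apply/eqP.
  rewrite eq_mulgV1; apply: contraNT xW => st; apply: fixW st _.
    by rewrite groupM ?groupV.
  rewrite phiM ?groupV // ractM e -ractM -phiM ?groupV // mulgV phi1.
  exact: ract1.
have ON y : y \in O -> y \notin (Z `|` F)%fset.
  case/imfsetP => s /= sO ->; apply/negP => h.
  have /eqP[] := xO _ s^-1%g h (groupVr sO).
  by rewrite -ractM -phiM ?groupV // mulgV phi1 ract1.
exists (O `|` F)%fset; split.
- move=> y; rewrite in_fsetU => /orP[/ON|/FZ //].
  by rewrite in_fsetU negb_or => /andP[].
- move=> y s; rewrite !in_fsetU => /orP[/imfsetP[t /= tO ->]|yF] sO.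
    apply/orP; left; apply/imfsetP; exists (t * s)%g; first by rewrite /= groupM.
    by rewrite phiM // ractM.
  by rewrite Finv ?orbT.
have dis : (O `&` F = fset0)%fset.
  apply/eqP; rewrite fsetI_eq0; apply/fdisjointP => y /ON.
  by rewrite in_fsetU negb_or => /andP[].
by rewrite cardfsU dis cardfs0 subn0 cO cF mulSn.
Qed.

Lemma necessity : robust Theta.
Proof.
have [_ trans _] := sharp.
have [a [phi [aI ca phiM phiE stab]]] := frame.
have phi1 : phi 1%g = 1%g by apply: (@mulgI _ (phi 1%g)); rewrite -phiM // !mulg1.
(* Such a [g] stabilises the numbered k-set, so it is some [phi s], and [s] fixes every index. *)
have rigid g : (forall i, to (a i) g = a i) -> g = 1%g.
  move=> ga; have [|s sT eg] := stab g.
    by apply/seteqP; split=> [_ [_ [i _ <-] <-]|_ [i _ <-]]; [exists i; rewrite ?ga|exists (a i); rewrite ?ga //; exists i].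
  suff -> : g = phi 1%g by [].
  rewrite eg; congr phi; apply/permP => i; rewrite perm1; apply: aI.
  by rewrite -[s i]/(aperm i s) -phiE // -eg ga.
(* An element with infinitely many fixed points fixes a k-set pointwise, so a conjugate of it is
   trivial by [rigid]. *)
have fixfin g : g <> 1%g -> exists Z : {fset U}, forall x, to x g = x -> x \in Z.
  move=> g1; have [/finite_fsetP[Z eZ]|inf] := pselect (finite_set [set x | to x g = x]).
    by exists Z => x xg; move/seteqP: eZ => [h _]; exact: h.
  have [B BF kB] := infinite_set_fset k inf.
  have [A [/fsubsetP AB /card_eq_fsetP cA]] := fset_subset_card kB.
  have [h hA] := trans _ _ ca cA; case: g1.
  apply: (mulgI h); apply: (mulIg h^-1%g); rewrite mulg1 mulgV; apply: rigid => i.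
  have : [set` A] (to (a i) h) by rewrite -hA; exists (a i) => //; exists i.
  move=> /AB/BF /= e; rewrite !ractM e; exact: ractK.
have phi_neq s : s \in Theta -> s != 1%g -> phi s <> 1%g.
  move=> sT /eqP s1 e; apply: s1; apply/permP => i; rewrite perm1; apply: aI.
  by rewrite -[s i]/(aperm i s) -phiE // e ract1.
move=> Om X OT X0 actX XN; apply/negP => /dvdnP[p eX].
have OmT s : s \in Om -> s \in Theta by move/(fintype.subsetP OT).
have invX i s : s \in Om -> (aperm i s \in X) = (i \in X).
  by move=> sO; exact: (actsP actX).
have [Z fixZ] : exists Z : {fset U}, forall s x, s \in enum Theta ->
    s != 1%g /\ to x (phi s) = x -> x \in Z.
  apply: finite_cover => s; rewrite mem_enum => sT.
  have [->|s1] := eqVneq s 1%g; first by exists fset0 => x [].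
  by have [Z hZ] := fixfin _ (phi_neq _ sT s1); exists Z => x [_ /hZ].
pose A := [fset a i | i : 'I_k]%fset; pose R := [fset a i | i in ~: X]%fset.
pose W := (A `|` Z)%fset.
pose ok (B : {fset U}) := [/\ #|` B| = k, (R `<=` B)%fset &
  forall x s, x \in B -> s \in Om -> to x (phi s) \in B].
(* For [i] outside [X], the point [a i] lies in [B], so [g^-1] takes it into [A]. For [i] in [X],
   some nontrivial [s] in [Om] fixes [i], and conjugating [phi s] by [g] gives a nontrivial [phi t]
   that fixes the point in question. *)
have data B g : ok B -> to^~ g @` range a = [set` B] ->
    forall i, to (a i) g^-1%g \in W.
  move=> [_ /fsubsetP RB invB] gB i; rewrite in_fsetU.
  have [iX|iX] := boolP (i \in X); last first.
    have : [set` B] (a i) by apply: RB; apply/imfsetP; exists i; rewrite //= finset.inE.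
    rewrite -gB => -[_ [j _ <-] <-]; rewrite ractK.
    by apply/orP; left; apply/imfsetP; exists j.
  have [s [sO s1 si]] := NFrP (fintype.subsetP XN _ iX).
  apply/orP; right.
  have imB : to^~ (phi s) @` [set` B] = [set` B].
    apply/seteqP; split=> [_ [x xB <-]|x xB]; first exact: invB.
    exists (to x (phi s^-1%g)); first by apply: invB; rewrite ?groupV.
    by rewrite -ractM -phiM ?OmT ?groupV // mulVg phi1 ract1.
  have [|t tT et] := stab (g * phi s * g^-1)%g.
    by rewrite !image_ractM gB imB; exact: image_ractK.
  apply: (fixZ t); first by rewrite mem_enum.
  split; last first.
    rewrite -et -!ractM !mulgA mulVg mul1g ractM phiE ?OmT //.
    by rewrite si.
  apply: contra_notN (phi_neq _ (OmT _ sO) s1) => /eqP t1.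
  apply: (mulgI g); apply: (mulIg g^-1%g); rewrite et t1 phi1.
  by rewrite mulg1 mulgV.
(* By [rigid] the tuple [d] of points determines [g], and hence [B]; as [W] is finite, so is the
   number of sets [B]. *)
have /choice[psi psiP] : forall d : {ffun 'I_k -> W}, exists B0 : {fset U},
    forall B g, ok B -> to^~ g @` range a = [set` B] ->
      (forall i, to (a i) g^-1%g = val (d i)) -> B = B0.
  move=> d; have [[B0 [g0 [k0 gB0 d0]]]|no] := pselect (exists B g,
    [/\ ok B, to^~ g @` range a = [set` B] & forall i, to (a i) g^-1%g = val (d i)]).
    exists B0 => B g kB gB dB; suff eg : g = g0.
      apply/fsetP => x; have e : [set` B] = [set` B0] by rewrite -gB -gB0 eg.
      by move/seteqP: e => [h1 h2]; apply/idP/idP => [/h1|/h2].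
    apply: (@mulgI _ g^-1%g); rewrite mulVg; apply/esym/rigid => i.
    by rewrite ractM dB -d0 ractKV.
  by exists fset0 => B g kB gB dB; case: no; exists B, g.
have [Z1 hZ1] : exists Z1 : {fset U}, forall d x, d \in enum {ffun 'I_k -> W} ->
    x \in psi d -> x \in Z1.
  by apply: finite_cover => d _; exists (psi d).
have okZ B x : ok B -> x \in B -> x \in Z1.
  move=> kB xB; have [cB _ _] := kB.
  have [g gB] := trans _ _ ca (introT card_eq_fsetP cB).
  pose d := [ffun i => [` data _ _ kB gB i]%fset].
  apply: (hZ1 d); first by rewrite mem_enum.
  by rewrite -(psiP d B g) // => i; rewrite ffunE.
have fixW x s : s \in Om -> s != 1%g -> to x (phi s) = x -> x \in W.
  by move=> sO s1 sx; rewrite in_fsetU (fixZ s) ?orbT // mem_enum OmT.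
have phiMO s t : s \in Om -> t \in Om -> phi (s * t)%g = (phi s * phi t)%g.
  by move=> sO tO; apply: phiM; exact: OmT.
(* Replacing the points of [X] by [p] fresh orbits keeps the size [k], because [#|X|] is
   [p * #|Om|], and gives an admissible set with points outside [Z1]. *)
have [F [FN Finv cF]] := fresh_orbits phiMO fixW p (Z1 `|` A)%fset.
have dis : (R `&` F = fset0)%fset.
  apply/eqP; rewrite fsetI_eq0; apply/fdisjointP => y /imfsetP[i _ ->].
  apply/negP => /FN; rewrite in_fsetU negb_or => /andP[_ /negP]; apply.
  by apply/imfsetP; exists i.
have okF : ok (R `|` F)%fset.
  split.
  - rewrite cardfsU dis cardfs0 subn0 cF -eX card_imfset //= -cardE addnC.
    by rewrite cardsC card_ord.
  - exact: fsubsetUl.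
  - move=> x s; rewrite !in_fsetU => /orP[/imfsetP[i /= iX ->]|xF] sO.
      apply/orP; left; apply/imfsetP; exists (aperm i s); last by rewrite phiE ?OmT.
      by move: iX; rewrite /= !finset.inE invX.
    by rewrite Finv ?orbT.
have [F0|[y yF]] := fset_0Vmem F.
  by move/eqP: cF; rewrite F0 cardfs0 -eX eq_sym cards_eq0 (negPf X0).
have /FN := yF; rewrite in_fsetU (okZ (R `|` F)%fset) //.
by rewrite in_fsetU yF orbT.
Qed.

End Necessity.

Theorem theorem1 (k : nat) (Theta : {group 'S_k}) (hk : (1 <= k)%N) :
  ((exists (G : groupType) (U : Type) (to : right_action G U),
      infinite_set [set: U]%classic /\ sharply_transitive to Theta)
   <-> robust Theta)
  /\
  ((exists (G : groupType) (U : Type) (to : right_action G U),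
      infinite_set [set: U]%classic /\ sharply_transitive to Theta) ->
   exists (G : groupType) (U : Type) (to : right_action G U),
     [/\ infinite_set [set: U]%classic,
         sharply_transitive to Theta,
         finitely_generated G,
         ~ abelian_group G
       & virtually_free G]).
Proof.
have nec : (exists (G : groupType) (U : Type) (to : right_action G U),
    infinite_set [set: U]%classic /\ sharply_transitive to Theta) -> robust Theta.
  move=> [G [U [to [infU sharp]]]].
  (* Finite subsets of [U] need a choice structure, which is supplied classically. *)
  exact: (@necessity k Theta G {classic U} to infU sharp).
split; last by move=> /nec; exact: action_exists.
split=> // /(action_exists hk)[G [U [to [infU sharp _ _ _]]]].
by exists G, U, to.
Qed.
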